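(* Consider the initial value problem $\dot{\boldsymbol{u}}(t)=\boldsymbol{f}(t,\boldsymbol{u}(t))$, $t\in[t_0,t_e]$, $\boldsymbol{u}(t_0)=\boldsymbol{u}_0$, with $\boldsymbol{f}:[t_0,t_e]\times\mathbb{R}^d\to\mathbb{R}^d$, and the quantity of interest $J(\boldsymbol{u})=\int_{t_0}^{t_e}j(t,\boldsymbol{u}(t))\,dt$ with $j:[t_0,t_e]\times\mathbb{R}^d\to\mathbb{R}$. Let $\boldsymbol{f}$ and $j$ be sufficiently smooth. Assume an adaptive method, depending on a tolerance $\tau>0$, consisting of: 1. a pair of one-step schemes $\mathcal{N}^{t,\Delta t}$, $\mathcal{N}_-^{t,\Delta t}$ of orders $p$, $\hat p$ with $p>\hat p$, the solution being advanced by $\boldsymbol{u}_{n+1}=\mathcal{N}^{t_n,\Delta t_n}\boldsymbol{u}_n$, $t_{n+1}=t_n+\Delta t_n$; 2. a quadrature scheme of order $r$ giving the approximation $J_h(\boldsymbol{u}_h)=\sum_{n=0}^{N-1}\Delta t_n\sum_{k=0}^s\sigma_k\,j(t_n^{(k)},\boldsymbol{u}_n^{(k)})$ of $J(\boldsymbol{u})$; 3. schemes $\mathcal{N}_{(k)}^{t,\Delta t}$ yielding solutions of order $p-1$ at all quadrature evaluation points $t_n^{(k)}$ that are not part of the resulting grid, i.e. $\boldsymbol{u}_n^{(k)}=\mathcal{N}_{(k)}^{t_n,\Delta t_n^{(k)}}\boldsymbol{u}_n$ with $\Delta t_n^{(k)}=t_n^{(k)}-t_n$; 4. the error estimator $\Delta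 t_n\hat\ell_n^j$ with $\hat\ell_n^j=j(t_{n+1},\mathcal{N}_-^{t_n,\Delta t_n}\boldsymbol{u}_n)-j(t_{n+1},\mathcal{N}^{t_n,\Delta t_n}\boldsymbol{u}_n)$; 5. the deadbeat controller $\displaystyle \Delta t_{n+1}=\Delta t_n\left(\frac{\tau}{|\hat\ell_n^j|}\right)^{1/(\hat p+1)}$; 6. an initial timestep $\Delta t_0=\mathcal{O}(\tau^{1/(\hat p+1)})$. If the principal error function $\boldsymbol{\phi}_-$ of $\mathcal{N}_-^{t,\Delta t}$ fulfills $$\min_{t\in[t_0,t_e]}\left|\frac{\partial j(t,\boldsymbol{u}(t))}{\partial\boldsymbol{u}}\,\boldsymbol{\phi}_-(t,\boldsymbol{u}(t))\right|>0,$$ then $$e^J:=|J(\boldsymbol{u})-J_h(\boldsymbol{u}_h)|=\mathcal{O}(\tau^{p/(\hat p+1)})\quad\text{for }\tau\to0.$$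
   Context: The initial value problem is assumed to have a unique solution $\boldsymbol{u}$. The flow map is $\mathcal{M}^{t,\Delta t}:\boldsymbol{u}(t)\mapsto\boldsymbol{u}(t+\Delta t)$, i.e. the solution operator of the differential equation from time $t$ to $t+\Delta t$. A one-step scheme is a numerical flow map $\mathcal{N}^{t,\Delta t}:\mathbb{R}^d\to\mathbb{R}^d$ approximating $\mathcal{M}^{t,\Delta t}$. A scheme $\mathcal{N}^{t,\Delta t}$ of order $p$ has principal error function $$\boldsymbol{\phi}(t,\boldsymbol{u}):=\lim_{\Delta t\to0}\frac{(\mathcal{N}^{t,\Delta t}-\mathcal{M}^{t,\Delta t})\boldsymbol{u}}{\Delta t^{p+1}},$$ and local error $(\mathcal{N}^{t_n,\Delta t_n}-\mathcal{M}^{t_n,\Delta t_n})\boldsymbol{u}_n=\Delta t_n^{p+1}\boldsymbol{\phi}(t_n,\boldsymbol{u}_n)+\mathcal{O}(\Delta t_n^{p+2})$. The function $\boldsymbol{\phi}_-$ is the one corresponding to $\mathcal{N}_-^{t,\Delta t}$ (with order $\hat p$). A scheme of order $p-1$ thus has local error $\mathcal{O}(\Delta t^{p})$. ''Sufficiently smooth'' means having as many continuous derivatives as required by the orders involved. The quadrature scheme has evaluation points $t_n^{(k)}=t_n+\gamma_k\Delta t_n$ with fixed $\gamma_k\in[0,1]$ and fixed weights $\sigma_k$, $k=0,\ldots,s$. It has order $r$ in the usual sense: its error on an interval of length $\Delta t$ is bounded by a constant times $\Delta t^{r+1}\max|g^{(r)}|$ for a smooth integrand $g$. The values $\boldsymbol{u}_n^{(k)}\approx\boldsymbol{u}(t_n^{(k)})$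 are the numerical approximations at the evaluation points; at evaluation points that are grid points, $\boldsymbol{u}_n^{(k)}$ is the numerical solution at that grid point. The grid is $t_0<t_1<\cdots<t_N=t_e$, where the last step is shortened if necessary so that $t_N=t_e$.
   Formalization: The quadrature order is additionally assumed to satisfy r ≥ p; for r < p the claim fails, e.g. f=1, u(t)=t and j=u² on [1,2], left-endpoint rule (r=1), p=2, p̂=1, where the error is of exact size τ^{1/2} and not O(τ). *)

(* Defs.v *)
From HB Require Import structures.
From mathcomp Require Import all_boot all_order all_algebra.
From mathcomp Require Import all_classical all_reals all_analysis.

Set Implicit Arguments.
Unset Strict Implicit.
Unset Printing Implicit Defensive.

Import Order.TTheory GRing.Theory Num.Theory.
Import numFieldNormedType.Exports.

Local Open Scope classical_set_scope.
Local Open Scope ring_scope.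

(* For V of finite dimension: continuity of all iterated directional
   derivatives of order at most k is the usual C^k. *)
Fixpoint Ck (R : realType) (V W : normedModType R) (k : nat) (F : V -> W) :
    Prop :=
  match k with
  | 0 => continuous F
  | k'.+1 => (forall x, differentiable F x) /\
             (forall v, Ck k' (fun x => 'D_v F x))
  end.

(* C^k on the closed slab [t0, te] x R^d, in the sense of restriction of a C^k
   function on R x R^d; values of F outside the slab are irrelevant. *)
Definition Ck_slab (R : realType) (d : nat) (W : normedModType R) (t0 te : R)
    (k : nat) (F : R -> 'rV[R]_d -> W) : Prop :=
  exists G : R * 'rV[R]_d -> W,
    Ck k G /\ forall t x, t0 <= t <= te -> G (t, x) = F t x.

Definition solves (R : realType) (d : nat) (f : R -> 'rV[R]_d -> 'rV[R]_d)
    (a b : R) (v : R -> 'rV[R]_d) : Prop :=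
  {within `[a, b], continuous v} /\
  (forall t, a < t < b -> is_derive t 1 v (f t (v t))).

Definition unique_solution (R : realType) (d : nat)
    (f : R -> 'rV[R]_d -> 'rV[R]_d) (a b : R) (x : 'rV[R]_d)
    (u : R -> 'rV[R]_d) : Prop :=
  [/\ solves f a b u, u a = x &
      forall v, solves f a b v -> v a = x -> {in `[a, b], u =1 v}].

(* The solution operator x = v(t) |-> v(t + h). The default value 0 is only
   taken when no solution through (t, x) exists on all of [t, t + h]. *)
Definition flow (R : realType) (d : nat) (f : R -> 'rV[R]_d -> 'rV[R]_d)
    (t h : R) (x : 'rV[R]_d) : 'rV[R]_d :=
  xget 0 [set y | exists v, [/\ solves f t (t + h) v, v t = x & v (t + h) = y]].

(* Numerical flow maps: N t h x stands for N^{t,h} x. *)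
Definition scheme (R : realType) (d : nat) := R -> R -> 'rV[R]_d -> 'rV[R]_d.

(* The flow leaves the domain of f for t = te and h > 0, so phi is the limit for
   t < te only; continuity determines phi at te. *)
Definition principal_error (R : realType) (d : nat)
    (f : R -> 'rV[R]_d -> 'rV[R]_d) (t0 te : R) (N : scheme R d) (p : nat)
    (phi : R -> 'rV[R]_d -> 'rV[R]_d) : Prop :=
  (forall t x, t0 <= t < te ->
     (h ^+ p.+1)^-1 *: (N t h x - flow f t h x) @[h --> 0^'+] --> phi t x) /\
  {within `[t0, te] `*` setT,
     continuous (fun z : R * 'rV[R]_d => phi z.1 z.2)}.

(* "Order p" means order at least p, as phi = 0 is allowed. The constant in the
   O(h^(p+2)) term is uniform in t and locally uniform in x. *)
Definition has_order (R : realType) (d : nat)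
    (f : R -> 'rV[R]_d -> 'rV[R]_d) (t0 te : R) (N : scheme R d) (p : nat) :
    Prop :=
  exists phi, principal_error f t0 te N p phi /\
    forall K : set 'rV[R]_d, compact K ->
      exists C h0 : R, 0 < h0 /\
        forall t h x, t0 <= t -> 0 < h <= h0 -> t + h <= te -> K x ->
          `|N t h x - flow f t h x - h ^+ p.+1 *: phi t x| <= C * h ^+ p.+2.

(* g 0 is C^r on [a, b] with successive derivatives g 1, ..., g r. *)
Definition derivatives_on (R : realType) (a b : R) (r : nat) (g : nat -> R -> R)
    : Prop :=
  (forall i, (i <= r)%N -> {within `[a, b], continuous (g i)}) /\
  (forall i t, (i < r)%N -> a < t < b -> is_derive t 1 (g i) (g i.+1 t)).

Definition quadrature_order (R : realType) (s : nat) (gamma sigma : 'I_s.+1 -> R)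
    (r : nat) : Prop :=
  exists C : R, forall (a h : R) (g : nat -> R -> R) (M : R),
    0 < h -> derivatives_on a (a + h) r g ->
    (forall t, a <= t <= a + h -> `|g r t| <= M) ->
    `|\int[lebesgue_measure]_(t in `[a, a + h]) g 0%N t
      - h * \sum_(k < s.+1) sigma k * g 0%N (a + gamma k * h)|
      <= C * h ^+ r.+1 * M.

Definition is_min_on (R : realType) (A : set R) (g : R -> R) (m : R) : Prop :=
  (exists2 t, A t & g t = m) /\ (forall t, A t -> m <= g t).

(* hat l_n^j at t = t_n, h = Delta t_n, x = u_n *)
Definition estimate (R : realType) (d : nat) (j : R -> 'rV[R]_d -> R)
    (N Nminus : scheme R d) (t h : R) (x : 'rV[R]_d) : R :=
  j (t + h) (Nminus t h x) - j (t + h) (N t h x).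

Record state (R : realType) (d : nat) :=
  State { time : R; value : 'rV[R]_d; step : R }.

(* (t_n, u_n, Delta t_n) for tolerance tau and initial timestep dt0; every
   timestep is cut off so as not to pass te. *)
Fixpoint run (R : realType) (d : nat) (j : R -> 'rV[R]_d -> R) (t0 te : R)
    (u0 : 'rV[R]_d) (N Nminus : scheme R d) (phat : nat) (tau dt0 : R)
    (n : nat) : state R d :=
  match n with
  | 0 => State t0 u0 (Num.min dt0 (te - t0))
  | n'.+1 =>
    let: State t x h := run j t0 te u0 N Nminus phat tau dt0 n' in
    State (t + h) (N t h x)
      (Num.min
         (h * (tau / `|estimate j N Nminus t h x|) `^ (phat.+1%:R^-1))
         (te - (t + h)))
  end.

(* t_0 < ... < t_m = te; at most one m satisfies this. *)
Definition is_grid (R : realType) (d : nat) (te : R) (st : nat -> state R d)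
    (m : nat) : Prop :=
  (forall n, (n < m)%N -> time (st n) < time (st n.+1)) /\ time (st m) = te.

(* u_n^(k): evaluation points with gamma_k = 0 or 1 are grid points. *)
Definition node_value (R : realType) (d s : nat) (N : scheme R d)
    (Nk : 'I_s.+1 -> scheme R d) (gamma : 'I_s.+1 -> R) (st : state R d)
    (k : 'I_s.+1) : 'rV[R]_d :=
  let: State t x h := st in
  if gamma k == 0 then x
  else if gamma k == 1 then N t h x
  else Nk k t (gamma k * h) x.

Definition QoI (R : realType) (d : nat) (j : R -> 'rV[R]_d -> R) (t0 te : R)
    (u : R -> 'rV[R]_d) : R :=
  \int[lebesgue_measure]_(t in `[t0, te]) j t (u t).

Definition QoI_h (R : realType) (d s : nat) (j : R -> 'rV[R]_d -> R)
    (N : scheme R d) (Nk : 'I_s.+1 -> scheme R d) (gamma sigma : 'I_s.+1 -> R)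
    (st : nat -> state R d) (m : nat) : R :=
  \sum_(n < m) step (st n) *
    \sum_(k < s.+1) sigma k *
      j (time (st n) + gamma k * step (st n)) (node_value N Nk gamma (st n) k).

(* Main.v *)
Require Import Defs.
From mathcomp Require Import all_boot all_order all_algebra.
From mathcomp Require Import all_classical all_reals all_analysis.
From mathcomp Require Import ring lra.

(** Why the error is of order tau^(p / (phat + 1)).

    Write q = phat + 1.  The estimate of a step of length h started at a point
    close to u(t) is the difference of j at the values of the two schemes.  By
    the mean value theorem it equals the slope of j in the direction of the
    difference of these values, which is h^q phi_minus up to O(h^(q + 1)).  As
    dj/du phi_minus is bounded, and bounded away from zero along the exact
    solution, the estimate lies between two positive multiples of h^q, uniformly
    in a tube around u ([estimator_bounds]).  The deadbeat controller multiplies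
    h by (tau / estimate)^(1/q), so the length of the old step cancels and every
    proposed step lies between two positive multiples of tau^(1/q)
    ([deadbeat_step_bounds]).  The upper bound, which the initial step shares by
    hypothesis, keeps all steps below some H = O(tau^(1/q)); the lower bound makes
    the run reach te ([run_reaches_end]).

    Steps below H give a global error O(H^p) by the discrete Gronwall inequality
    ([error_envelope_step]); for small tau this is smaller than the radius of the
    tube in which the estimates hold, so the two arguments run as one induction,
    whose invariant is [on_track].  The quadrature of order r >= p has error
    O(h H^p) on each step along the exact solution, whose derivatives are
    continuous functions of (t, u(t)) ([quadrature_error]), and the
    numerical values at the evaluation points deviate from u by O(H^p)
    ([node_value_error]).  Summation over the grid gives O(H^p), which is
    O(tau^(p/q)).

    All hypotheses on the schemes compare them with the flow of the differential
    equation, which is defined by choosing a solution if there is one.  So the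
    local theory of the initial value problem is needed at points off the
    trajectory: existence on short time intervals ([picard_existence]), and
    uniqueness and Lipschitz dependence on the initial value, both consequences of
    [solution_stability].  They are proved for the field truncated outside a box,
    which is bounded and Lipschitz, and carried over to the field itself in
    [flow_near_solution], the only statement about the flow that is used
    afterwards. *)

Set Implicit Arguments.
Unset Strict Implicit.
Unset Printing Implicit Defensive.

Import Order.TTheory GRing.Theory Num.Theory.
Import numFieldNormedType.Exports.

Local Open Scope classical_set_scope.
Local Open Scope ring_scope.

(** * Vectors, projections and the mean value inequality *)

Lemma rV_entry_le (R : realType) (d : nat) (x : 'rV[R]_d) i : `|x 0 i| <= `|x|.
Proof. by rewrite [leRHS]/Num.Def.normr /= mx_normrE (le_bigmax _ _ (0, i)). Qed.

Lemma rV_norm_le (R : realType) (d : nat) (x : 'rV[R]_d) (K : R) :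
  0 <= K -> (forall i, `|x 0 i| <= K) -> `|x| <= K.
Proof.
move=> K0 xK; rewrite [leLHS]/Num.Def.normr /= mx_normrE bigmax_le// => -[i j] _ /=.
by rewrite (ord1 i).
Qed.

Lemma is_derive_entry (R : realType) (d : nat) (v : R -> 'rV[R]_d)
    (t : R) (dv : 'rV[R]_d) i :
  is_derive t 1 v dv -> is_derive t 1 (fun s => v s 0 i) (dv 0 i).
Proof.
move=> [vt <-]; rewrite derive_mx// mxE; apply: DeriveDef => //.
by move/derivable_mxP : vt; exact.
Qed.

Lemma is_derive_rV (R : realType) (d : nat) (v : R -> 'rV[R]_d)
    (t : R) (dv : 'rV[R]_d) :
  (forall i, is_derive t 1 (fun s => v s 0 i) (dv 0 i)) -> is_derive t 1 v dv.
Proof.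
move=> h; have vt : derivable v t 1.
  by apply/derivable_mxP => k i; rewrite (ord1 k); case: (h i).
apply: DeriveDef => //; rewrite derive_mx//; apply/rowP => i; rewrite mxE.
by case: (h i).
Qed.

Lemma within_comp (T : topologicalType) (U V : topologicalType) (A : set T)
    (f : T -> U) (g : U -> V) :
  continuous g -> {within A, continuous f} -> {within A, continuous (g \o f)}.
Proof. by move=> cg cf; apply: within_continuous_comp => // x _; exact: cg. Qed.

Lemma within_itvS (R : realType) (V : topologicalType) (a b c e : R)
    (v : R -> V) : a <= c -> e <= b ->
  {within `[a, b], continuous v} -> {within `[c, e], continuous v}.
Proof.
move=> ac eb; apply: continuous_subspaceW => t /=; rewrite !in_itv/=.
by move=> /andP[ct te]; rewrite (le_trans ac ct) (le_trans te eb).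
Qed.

(** Since the norm is the maximum of the entries, the scalar mean value theorem
    applies entry by entry.  Only interior derivatives enter, so the inequality
    serves solutions in the sense of [solves], and estimates for solutions need
    no integrals. *)
Lemma mean_value_inequality (R : realType) (d : nat) (v dv : R -> 'rV[R]_d)
    (a b K : R) : a <= b -> 0 <= K -> {within `[a, b], continuous v} ->
  (forall t, a < t < b -> is_derive t 1 v (dv t)) ->
  (forall t, a < t < b -> `|dv t| <= K) -> `|v b - v a| <= K * (b - a).
Proof.
rewrite le_eqVlt => /predU1P[-> K0 _ _ _|ab K0 cv vd dvK].
  by rewrite !subrr normr0 mulr0.
apply: rV_norm_le => [|i]; first by rewrite mulr_ge0// subr_ge0 ltW.
have [t tab e] : exists2 c, c \in `]a, b[%R &
    v b 0 i - v a 0 i = dv c 0 i * (b - a).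
  apply: (@MVT _ (fun t => v t 0 i) (fun t => dv t 0 i)) => //.
    by move=> t; rewrite in_itv/= => tab; exact/is_derive_entry/vd.
  exact: (within_comp (@coord_continuous _ _ _ 0 i)).
rewrite !mxE e normrM ler_pM//; last by rewrite gtr0_norm// subr_gt0.
rewrite in_itv/= in tab.
exact: le_trans (rV_entry_le _ _) (dvK _ tab).
Qed.

(** Precomposition with the projection onto [a, b] makes a function that is
    continuous on [a, b] continuous on the whole line, which spares the subspace
    topology. *)
Definition clamp (R : realType) (a b t : R) := Num.max a (Num.min t b).

Lemma clamp_itv (R : realType) (a b t : R) : a <= b -> a <= clamp a b t <= b.
Proof. by move=> ab; rewrite /clamp le_max lexx ge_max ab ge_min lexx orbT. Qed.

Lemma clamp_id (R : realType) (a b t : R) : a <= t <= b -> clamp a b t = t.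
Proof. by move=> /andP[a_t tb]; rewrite /clamp (min_idPl tb) (max_idPr a_t). Qed.

Lemma clamp_lip (R : realType) (a b s t : R) :
  `|clamp a b s - clamp a b t| <= `|s - t|.
Proof.
wlog st : s t / s <= t.
  by move=> h; case: (leP s t) => [/h//|/ltW/h]; rewrite distrC (distrC t).
rewrite distrC (distrC s) (ger0_norm (_ : 0 <= t - s)) ?subr_ge0//.
rewrite /clamp ger0_norm.
  by case: (leP s b); case: (leP t b) => ? ?; do ? case: (leP a _) => ?;
    lra.
by case: (leP s b); case: (leP t b) => ? ?; do ? case: (leP a _) => ?; lra.
Qed.

Lemma lipschitz_continuous (R : realType) (V W : normedModType R) (f : V -> W)
    (L : R) : (forall x y, `|f x - f y| <= L * `|x - y|) -> continuous f.
Proof.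
move=> fL x; apply/cvgrPdist_lt => e e0; near=> y.
apply: (le_lt_trans (fL x y)).
have : `|x - y| < e / (`|L| + 1).
  by near: y; apply: cvgr_dist_lt => //; rewrite divr_gt0// ltr_wpDl.
rewrite ltr_pdivlMr ?ltr_wpDl//; apply: le_lt_trans.
rewrite mulrC ler_wpM2l// (le_trans (ler_norm _))// lerDl//.
Unshelve. all: by end_near. Qed.

Lemma clamp_continuous (R : realType) (a b : R) : continuous (clamp a b).
Proof.
apply: (@lipschitz_continuous _ _ _ (clamp a b) 1) => s t.
by rewrite mul1r; exact: clamp_lip.
Qed.

Lemma continuous_clamp (R : realType) (V : topologicalType) (a b : R)
    (v : R -> V) : a <= b -> {within `[a, b], continuous v} ->
  continuous (v \o clamp a b).
Proof.
move=> ab /subspace_continuousP cv t.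
have := cv (clamp a b t); rewrite /= in_itv/= clamp_itv// => /(_ isT) h.
apply: (@cvg_comp _ _ _ (clamp a b) v (nbhs t)
  (within `[a, b] (nbhs (clamp a b t))) _ _ h) => A /=.
rewrite /within/= => wA; have := clamp_continuous wA; rewrite /= nbhs_simpl/=.
apply: filterS => s; apply.
by rewrite /= in_itv/= clamp_itv.
Qed.

Lemma is_derive_clamp (R : realType) (V : normedModType R) (a b t : R)
    (v : R -> V) dv : a < t < b -> is_derive t 1 v dv ->
  is_derive t 1 (v \o clamp a b) dv.
Proof.
move=> /andP[a_t tb]; apply: near_eq_is_derive; near=> s.
rewrite /= clamp_id//; apply/andP; split; near: s.
  by apply: filterS (lt_nbhsr a_t) => ? /ltW.
  by apply: filterS (lt_nbhsl tb) => ? /ltW.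
Unshelve. all: by end_near. Qed.

Lemma within_eq (R : realType) (V : topologicalType) (a b : R)
    (v w : R -> V) : (forall t, a <= t <= b -> v t = w t) ->
  {within `[a, b], continuous v} -> {within `[a, b], continuous w}.
Proof.
move=> vw; apply: subspace_eq_continuous => t.
by rewrite inE/= in_itv/= => /vw.
Qed.

Definition clip (R : realType) (d : nat) (B : R) (x : 'rV[R]_d) : 'rV[R]_d :=
  \row_i clamp (- B) B (x 0 i).

Lemma clip_id (R : realType) (d : nat) (B : R) (x : 'rV[R]_d) :
  `|x| <= B -> clip B x = x.
Proof.
move=> xB; apply/rowP => i; rewrite mxE clamp_id// -ler_norml.
exact: le_trans (rV_entry_le _ _) xB.
Qed.

Lemma clip_norm (R : realType) (d : nat) (B : R) (x : 'rV[R]_d) :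
  0 <= B -> `|clip B x| <= B.
Proof.
move=> B0; apply: rV_norm_le => // i; rewrite mxE ler_norml clamp_itv//.
by rewrite ge0_cp.
Qed.

Lemma clip_lip (R : realType) (d : nat) (B : R) (x y : 'rV[R]_d) :
  `|clip B x - clip B y| <= `|x - y|.
Proof.
apply: rV_norm_le => // i; rewrite !mxE (le_trans (clamp_lip _ _ _ _))//.
by have := rV_entry_le (x - y) i; rewrite !mxE.
Qed.

Lemma clip_continuous (R : realType) (d : nat) (B : R) :
  continuous (@clip R d B).
Proof.
apply: (@lipschitz_continuous _ _ _ (@clip R d B) 1) => s t.
by rewrite mul1r; exact: clip_lip.
Qed.

(** * Existence of solutions by Picard iteration *)

Lemma pair_continuous (T U V : topologicalType) (f : T -> U) (g : T -> V) :
  continuous f -> continuous g -> continuous (fun x => (f x, g x)).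
Proof. by move=> cf cg x; exact: (cvg_pair (cf x) (cg x)). Qed.

Lemma primitive_exists (R : realType) (g : R -> R) (a b : R) : a < b ->
  continuous g -> exists P : R -> R, [/\ continuous P, P a = 0 &
    forall t, a < t < b -> is_derive t 1 P (g t)].
Proof.
move=> ab cg; pose mu := @lebesgue_measure R.
pose P t := \int[mu]_(s in `[a, t]) g s.
have gi (c : R) : mu.-integrable `[a, c] (EFin \o g).
  apply: continuous_compact_integrable; first exact: segment_compact.
  exact: continuous_subspaceT.
exists (P \o clamp a b); split.
- apply: continuous_clamp (ltW ab) _.
  by apply: parameterized_integral_continuous (ltW ab) _; exact: gi.
- by rewrite /= clamp_id ?lexx ?ltW// /P set_itv1 Rintegral_set1.
- move=> t tab; apply: is_derive_clamp (tab) _; case/andP: tab => a_t tb.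
  have [dP] := @continuous_FTC1_closed _ g a t b tb (gi b) a_t (cg t).
  by rewrite derive1E => e; exact: DeriveDef dP e.
Qed.

Lemma primitive_rV_exists (R : realType) (d : nat) (g : R -> 'rV[R]_d)
    (a b : R) (x : 'rV[R]_d) : a < b -> continuous g ->
  exists P : R -> 'rV[R]_d, [/\ continuous P, P a = x &
    forall t, a < t < b -> is_derive t 1 P (g t)].
Proof.
move=> ab cg.
have /choice[P HP] : forall i, exists P : R -> R, [/\ continuous P, P a = 0 &
    forall t, a < t < b -> is_derive t 1 P (g t 0 i)].
  move=> i; apply: (@primitive_exists _ (fun t => g t 0 i)) => // t.
  apply: (@continuous_comp _ _ _ g (fun x : 'rV[R]_d => x 0 i)); first exact: cg.
  exact: coord_continuous.
exists (fun t => x + \row_i P i t); split.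
- move=> t; apply: cvgD; first exact: cvg_cst.
  apply/cvgrPdist_le => e e0; near=> s.
  apply: rV_norm_le; first exact: ltW.
  move=> i; rewrite !mxE; move: i; near: s; apply: filter_forall => i.
  have [cP _ _] := HP i.
  by apply: (@cvgr_dist_le _ _ _ (nbhs t) _ (P i)); [exact: cP|].
- by apply/rowP => i; rewrite !mxE; have [_ -> _] := HP i; rewrite addr0.
- move=> t tab; apply: is_derive_rV => i.
  have [_ _ /(_ _ tab) dP] := HP i.
  under eq_fun do rewrite !mxE.
  rewrite -[X in is_derive _ _ _ X]add0r; apply: is_deriveD.
Unshelve. all: by end_near. Qed.

(** The rate is part of the conclusion because the limit of the Picard iterates,
    taken at each time separately, has to be uniform in time. *)
Lemma geometric_limit (R : realType) (x : nat -> R) (c : R) :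
  (forall k, `|x k.+1 - x k| <= c * 2^-1 ^+ k) ->
  exists l, forall k, `|x k - l| <= 2 * c * 2^-1 ^+ k.
Proof.
move=> xc.
have tail k m : `|x (k + m)%N - x k| <= 2 * c * 2^-1 ^+ k * (1 - 2^-1 ^+ m).
  elim: m => [|m IH]; first by rewrite addn0 subrr normr0 expr0 subrr mulr0.
  rewrite addnS -(subrK (x (k + m)%N) (x _.+1)) -addrA.
  rewrite (le_trans (ler_normD _ _))// (le_trans (lerD (xc _) IH))//.
  rewrite exprD exprS; set A := _ ^+ k; set B := _ ^+ m; lra.
have c0 : 0 <= c by have := xc 0%N; rewrite expr0 mulr1; exact: le_trans.
have pos k : 0 <= (2^-1 : R) ^+ k by rewrite exprn_ge0// invr_ge0.
have tail' k m : `|x (k + m)%N - x k| <= 2 * c * 2^-1 ^+ k.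
  by rewrite (le_trans (tail _ _))// ler_piMr ?mulr_ge0// gerBl.
have small e : 0 < e -> \forall k \near \oo, 2 * c * 2^-1 ^+ k < e.
  move=> e0; have := @cvg_geometric R (2 * c) 2^-1.
  rewrite ger0_norm ?invr_ge0// => /(_ _)/cvgrPdist_lt/(_ _ e0).
  rewrite invf_lt1// ltr1n => /(_ isT); apply: filterS => k.
  by rewrite sub0r normrN; apply: le_lt_trans; exact: ler_norm.
have cx : cvgn x.
  apply/cauchy_cvgP/cauchy_exP => e e0.
  have [N _ HN] := small e e0; exists (x N), N => // n /= Nn.
  rewrite -ball_normE /= distrC -(subnKC Nn) (le_lt_trans (tail' _ _))//.
  exact: (HN N (leqnn N)).
exists (limn x) => k; apply/ler_addgt0Pr => e e0.
have /cvgrPdist_lt/(_ _ e0)[N _ HN] := cx.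
rewrite -(subrK (x (k + N)%N) (x k)) -addrA (le_trans (ler_normD _ _))//.
rewrite lerD//; first by rewrite distrC tail'.
by rewrite distrC ltW// HN//= leq_addl.
Qed.

Lemma geometric_limit_rV (R : realType) (d : nat) (x : nat -> 'rV[R]_d)
    (c : R) : (forall k, `|x k.+1 - x k| <= c * 2^-1 ^+ k) ->
  exists l, forall k, `|x k - l| <= 2 * c * 2^-1 ^+ k.
Proof.
move=> xc; have /choice[l Hl] : forall i, exists l, forall k,
    `|x k 0 i - l| <= 2 * c * 2^-1 ^+ k.
  move=> i; apply: geometric_limit => k; apply: le_trans (xc k).
  by have := rV_entry_le (x k.+1 - x k) i; rewrite !mxE.
have c0 : 0 <= c by have := xc 0%N; rewrite expr0 mulr1; exact: le_trans.
exists (\row_i l i) => k; apply: rV_norm_le => [|i]; last by rewrite !mxE.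
by rewrite !mulr_ge0// exprn_ge0// invr_ge0.
Qed.

Lemma uniform_limit_continuous_at (R : realType) (V W : normedModType R)
    (f : nat -> V -> W) (g : V -> W) (e_ : nat -> R) :
  (forall k, continuous (f k)) -> (forall k x, `|f k x - g x| <= e_ k) ->
  e_ @ \oo --> 0 -> continuous g.
Proof.
move=> cf fg ce x; apply/cvgrPdist_le => e e0.
have e30 : 0 < e / 3 by rewrite divr_gt0.
have /cvgrPdist_lt/(_ _ e30)[k _ /(_ k (leqnn k))/=] := ce.
rewrite sub0r normrN => /(le_lt_trans (ler_norm _)) ek; near=> y.
have h : `|f k x - f k y| <= e / 3.
  by near: y; apply: (@cvgr_dist_le _ _ _ (nbhs x) _ (f k)) => //; exact: cf.
have -> : g x - g y = (g x - f k x) + (f k x - f k y) + (f k y - g y).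
  by rewrite !addrA !subrK.
rewrite (le_trans (ler_normD _ _))//.
have := ler_normD (g x - f k x) (f k x - f k y).
have := fg k x; have := fg k y; rewrite (distrC (f k x) (g x)); lra.
Unshelve. all: by end_near. Qed.

(** Picard iteration for a field that is globally bounded and globally Lipschitz
    in the state.  On an interval of length h with L h <= 1/2 the iterates
    contract by a factor two; each iterate is a primitive of the field along the
    previous one, so all estimates come from the mean value inequality. *)
Lemma picard_existence (R : realType) (d : nat)
    (F : R -> 'rV[R]_d -> 'rV[R]_d) (M L a h : R) (x : 'rV[R]_d) :
  continuous (fun z : R * 'rV[R]_d => F z.1 z.2) ->
  (forall t y, `|F t y| <= M) ->
  (forall t y z, `|F t y - F t z| <= L * `|y - z|) ->
  0 < h -> 0 <= L -> L * h <= 2^-1 ->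
  exists2 v, solves F a (a + h) v & v a = x.
Proof.
move=> cF FM FL h0 L0 Lh.
have ah : a < a + h by rewrite ltrDl.
have M0 : 0 <= M := le_trans (normr_ge0 _) (FM 0 0).
have cFv (v : R -> 'rV[R]_d) : continuous v -> continuous (fun t => F t (v t)).
  move=> cv t; apply: (@continuous_comp _ _ _ (fun t => (t, v t))
    (fun z : R * 'rV[R]_d => F z.1 z.2)); last exact: cF.
  exact: (pair_continuous (fun t => @cvg_id _ (nbhs t)) cv).
have /choice[T HT] : forall v : R -> 'rV[R]_d, exists P : R -> 'rV[R]_d,
    continuous v -> [/\ continuous P, P a = x &
    forall t, a < t < a + h -> is_derive t 1 P (F t (v t))].
  move=> v; have [cv|ncv] := pselect (continuous v); last by exists v.
  by have [P HP] := primitive_rV_exists x ah (cFv _ cv); exists P.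
have contr v w K : continuous v -> continuous w -> 0 <= K ->
    (forall t, a <= t <= a + h -> `|v t - w t| <= K) ->
    forall t, a <= t <= a + h -> `|T v t - T w t| <= L * h * K.
  move=> cv cw K0 vwK t /andP[a_t th].
  have [cTv va Dv] := HT v cv; have [cTw wa Dw] := HT w cw.
  have := @mean_value_inequality R d (T v \- T w)
    (fun t => F t (v t) - F t (w t)) a t (L * K) a_t (mulr_ge0 L0 K0).
  rewrite /= va wa subrr subr0 => H; apply: (le_trans (H _ _ _)).
  - apply: continuous_subspaceT => s; apply: cvgB; [exact: cTv|exact: cTw].
  - move=> s /andP[a_s st].
    by apply: is_deriveB; [apply: Dv|apply: Dw]; rewrite a_s (lt_le_trans st).
  - move=> s /andP[a_s st]; apply: (le_trans (FL _ _ _)).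
    by rewrite ler_wpM2l// vwK// ltW//= ltW// (lt_le_trans st).
  by rewrite (mulrAC L h) ler_wpM2l ?mulr_ge0// lerBlDl.
pose X := fix X k := if k is k'.+1 then T (X k') else fun=> x : 'rV[R]_d.
have cX k : continuous (X k).
  by elim: k => [|k IH] /=; [move=> ?; exact: cvg_cst|have [] := HT _ IH].
have X0 t : a <= t <= a + h -> `|X 1%N t - X 0%N t| <= M * h.
  move=> /andP[a_t th]; have [cT Ta DT] := HT (X 0%N) (cX 0%N).
  rewrite /= -[x in _ - x]Ta.
  have := @mean_value_inequality R d (X 1%N) _ a t M a_t M0 _ _ _.
  move=> H; apply: le_trans (H (fun t => F t x) _ _ _) _ => //.
  - exact: continuous_subspaceT.
  - by move=> s /andP[a_s st]; apply: DT; rewrite a_s (lt_le_trans st).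
  by rewrite ler_wpM2l// lerBlDl.
have Xk k t : a <= t <= a + h -> `|X k.+1 t - X k t| <= M * h * 2^-1 ^+ k.
  elim: k t => [|k IH] t tah; first by rewrite expr0 mulr1 X0.
  have Kp : 0 <= M * h * 2^-1 ^+ k.
    by rewrite !mulr_ge0 ?exprn_ge0 ?invr_ge0// ltW.
  apply: (le_trans (contr _ _ _ (cX k.+1) (cX k) Kp IH t tah)).
  have := ler_wpM2r Kp Lh; rewrite exprS; set A := _ ^+ k; lra.
pose Y k t := X k (clamp a (a + h) t).
have cY k : continuous (Y k).
  by apply: (@continuous_clamp _ _ _ _ (X k)); [exact: ltW|exact: continuous_subspaceT].
have /choice[v Hv] : forall t, exists l, forall k,
    `|Y k t - l| <= 2 * (M * h) * 2^-1 ^+ k.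
  by move=> t; apply: geometric_limit_rV => k; apply: Xk; rewrite clamp_itv// ltW.
have ce : (fun k => 2 * (M * h) * 2^-1 ^+ k) @ \oo --> (0 : R).
  by apply: cvg_geometric; rewrite ger0_norm ?invr_ge0// invf_lt1// ltr1n.
have cv : continuous v := uniform_limit_continuous_at cY (fun k t => Hv t k) ce.
have [cT Ta DT] := HT v cv.
have vT t : a <= t <= a + h -> v t = T v t.
  move=> tah; apply/eqP; rewrite -subr_eq0 -normr_le0; apply/ler_addgt0Pr => e e0.
  have /cvgrPdist_lt/(_ _ e0)[k _ /(_ k (leqnn k))/=] := ce.
  rewrite sub0r normrN => /(le_lt_trans (ler_norm _)) ek.
  have Kp : 0 <= 2 * (M * h) * 2^-1 ^+ k.
    by rewrite !mulr_ge0 ?exprn_ge0 ?invr_ge0// ltW.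
  have vk s : a <= s <= a + h -> `|X k s - v s| <= 2 * (M * h) * 2^-1 ^+ k.
    by move=> sah; have := Hv s k; rewrite /Y clamp_id.
  have H1 := contr _ _ _ (cX k) cv Kp vk t tah.
  have H2 := Hv t k.+1; rewrite /Y clamp_id//= in H2.
  rewrite add0r -(subrK (T (X k) t) (v t)) -addrA (le_trans (ler_normD _ _))//.
  have H3 := ler_wpM2r Kp Lh.
  rewrite distrC; move: H1 H2 H3 ek; rewrite exprS; lra.
exists (T v); last by [].
split; first exact: continuous_subspaceT.
by move=> t tah; rewrite -vT; [exact: DT|case/andP: tah => ? ?; rewrite !ltW].
Qed.

(** * Functions of class C^1 on a box *)

Lemma ball_rV_compact (R : realType) (d : nat) (B : R) :
  compact [set x : 'rV[R]_d | `|x| <= B].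
Proof.
apply: bounded_closed_compact.
  exists B; split; first exact: num_real.
  by move=> M BM x /= xB; exact: le_trans xB (ltW BM).
rewrite (_ : [set x | _] = (fun x : 'rV[R]_d => `|x|) @^-1` [set y | y <= B])//.
by apply: preimage_closed; [move=> x _; exact: norm_continuous|exact: closed_le].
Qed.

Lemma bounded_on_box (R : realType) (d : nat) (W : normedModType R)
    (g : R * 'rV[R]_d -> W) (t0 te B : R) : continuous g ->
  exists2 M, 0 <= M & forall t x, t0 <= t <= te -> `|x| <= B -> `|g (t, x)| <= M.
Proof.
move=> cg; have cK : compact (`[t0, te] `*` [set x : 'rV[R]_d | `|x| <= B]).
  exact: compact_setX (@segment_compact _ _ _) (@ball_rV_compact _ _ _).
have /compact_bounded[M [_ HM]] : compact (g @` (`[t0, te] `*`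
    [set x : 'rV[R]_d | `|x| <= B])).
  by apply: continuous_compact => //; exact: continuous_subspaceT.
exists (`|M| + 1); first by rewrite ltW// ltr_wpDl.
move=> t x tt xB; apply: (HM (`|M| + 1)).
  by rewrite (le_lt_trans (ler_norm _))// ltrDl.
by exists (t, x) => //; split => //=; rewrite in_itv.
Qed.

Lemma is_derive_pair (R : realType) (V W : normedModType R) (a : R -> V)
    (b : R -> W) (t : R) da db : is_derive t 1 a da -> is_derive t 1 b db ->
  is_derive t 1 (fun s => (a s, b s)) (da, db).
Proof.
move=> [Da <-] [Db <-]; have fa := proj1 (derivable1_diffP _ _) Da.
have fb := proj1 (derivable1_diffP _ _) Db.
have fab := differentiable_pair fa fb.
apply: DeriveDef; first exact/derivable1_diffP.
by rewrite !deriveE// diff_pair.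
Qed.

Lemma is_derive_along (R : realType) (V W : normedModType R) (F : V -> W)
    (c : R -> V) (t : R) dc : differentiable F (c t) -> is_derive t 1 c dc ->
  is_derive t 1 (F \o c) ('d F (c t) dc).
Proof.
move=> dF [Dc <-]; have fc := proj1 (derivable1_diffP _ _) Dc.
have fFc := differentiable_comp fc dF.
apply: DeriveDef; first exact/derivable1_diffP.
by rewrite !deriveE// diff_comp.
Qed.

(** The derivative of F at z in the direction (0, w), written through the
    partial derivatives because those are continuous in z for F of class C^1. *)
Definition slope (R : realType) (d : nat) (F : R * 'rV[R]_d -> R)
    (z : R * 'rV[R]_d) (w : 'rV[R]_d) : R :=
  \sum_i w 0 i * 'D_(0, delta_mx 0 i) F z.

Lemma slopeE (R : realType) (d : nat) (F : R * 'rV[R]_d -> R) z w :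
  differentiable F z -> slope F z w = 'd F z (0, w).
Proof.
move=> dF; have -> : (0, w) = \sum_i w 0 i *: (0, delta_mx 0 i) :> R * 'rV[R]_d.
  rewrite [RHS]surjective_pairing; congr pair.
    rewrite (big_morph fst (id1 := 0) (op1 := +%R))//.
    by rewrite big1// => i _ /=; rewrite scaler0.
  by rewrite (big_morph snd (id1 := 0) (op1 := +%R))//= -row_sum_delta.
rewrite linear_sum; apply: eq_bigr => i _.
by rewrite linearZ deriveE.
Qed.

Lemma slope_differential (R : realType) (d : nat) (F : R * 'rV[R]_d -> R)
    (t : R) (x w : 'rV[R]_d) : differentiable F (t, x) ->
  'd (fun y => F (t, y)) x w = slope F (t, x) w.
Proof.
move=> dF; rewrite slopeE//.
have dp : is_diff x (fun y : 'rV[R]_d => (t, y)) (fun y => (0, y)).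
  exact: is_diff_pair.
have -> : (fun y => F (t, y)) = F \o (fun y => (t, y)) by [].
have dd : differentiable (fun y : 'rV[R]_d => (t, y)) x by [].
by rewrite diff_comp//= diff_val.
Qed.

Lemma mean_value_slope (R : realType) (d : nat) (F : R * 'rV[R]_d -> R)
    (t : R) (x y : 'rV[R]_d) : (forall z, differentiable F z) ->
  exists2 s, 0 <= s <= 1 &
    F (t, x) - F (t, y) = slope F (t, y + s *: (x - y)) (x - y).
Proof.
move=> dF; pose c (s : R) := (t, y + s *: (x - y)).
have dc (s : R) : is_derive s 1 c (0, x - y).
  apply: is_derive_pair.
  rewrite -[X in is_derive _ _ _ X]add0r; apply: is_deriveD.
  have dl : differentiable (fun s : R => s *: (x - y)) s
    by exact: differentiableZl.
  apply: DeriveDef; first exact/derivable1_diffP.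
  by rewrite deriveE// diffZl//= diff_val scale1r.
have dFc (s : R) : is_derive s 1 (F \o c) (slope F (c s) (x - y)).
  by rewrite slopeE//; exact: is_derive_along.
have cFc : continuous (F \o c).
  by move=> s; apply/differentiable_continuous/derivable1_diffP; case: (dFc s).
have [s s01] := MVT_segment ler01 (fun s _ => dFc s) (continuous_subspaceT cFc).
rewrite subr0 mulr1 /= /c scale1r scale0r addr0 subrKC => e.
by exists s => //; rewrite in_itv in s01.
Qed.

Lemma Ck_continuous (R : realType) (V W : normedModType R) k (F : V -> W) :
  Ck k F -> continuous F.
Proof.
by case: k => [//|k] [dF _] x; exact/differentiable_continuous.
Qed.

Lemma Ck_le (R : realType) (V W : normedModType R) k l (F : V -> W) :
  (l <= k)%N -> Ck k F -> Ck l F.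
Proof.
elim: l k F => [|l IH] [|k] F //; first by move=> _; exact: Ck_continuous.
by rewrite ltnS => lk [dF HF]; split=> // v; exact: IH (HF v).
Qed.

Lemma slope_le (R : realType) (d : nat) (F : R * 'rV[R]_d -> R) (t0 te B : R) :
  Ck 1 F -> exists2 L, 0 <= L & forall t x w, t0 <= t <= te -> `|x| <= B ->
    `|slope F (t, x) w| <= L * `|w|.
Proof.
move=> [dF cF].
have /choice[M HM] : forall i : 'I_d, exists M, 0 <= M /\ forall t x,
    t0 <= t <= te -> `|x| <= B -> `|'D_(0, delta_mx 0 i) F (t, x)| <= M.
  move=> i; have [M M0 HM] := bounded_on_box t0 te B (cF (0, delta_mx 0 i)).
  by exists M.
exists (\sum_i M i); first by apply: sumr_ge0 => i _; case: (HM i).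
move=> t x w tt xB; rewrite mulr_suml (le_trans (ler_norm_sum _ _ _))//.
apply: ler_sum => i _; have [M0 /(_ t x tt xB) Mi] := HM i.
by rewrite normrM mulrC ler_pM// rV_entry_le.
Qed.

Lemma segment_norm (R : realType) (d : nat) (x y : 'rV[R]_d) (s B : R) :
  0 <= s <= 1 -> `|x| <= B -> `|y| <= B -> `|y + s *: (x - y)| <= B.
Proof.
move=> /andP[s0 s1] xB yB.
have -> : y + s *: (x - y) = (1 - s) *: y + s *: x.
  by rewrite scalerBr scalerBl scale1r addrCA addrA (addrC (s *: x)) addrAC.
rewrite (le_trans (ler_normD _ _))// !normrZ (ger0_norm s0) ger0_norm ?subr_ge0//.
have s1' : 0 <= 1 - s by rewrite subr_ge0.
have := ler_wpM2l s0 xB; have := ler_wpM2l s1' yB; lra.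
Qed.

Lemma C1_lipschitz (R : realType) (d : nat) (F : R * 'rV[R]_d -> R)
    (t0 te B : R) : Ck 1 F -> exists2 L, 0 <= L & forall t x y, t0 <= t <= te ->
    `|x| <= B -> `|y| <= B -> `|F (t, x) - F (t, y)| <= L * `|x - y|.
Proof.
move=> CF; have [L L0 HL] := slope_le t0 te B CF; exists L => // t x y tt xB yB.
have [s s01 ->] := mean_value_slope t x y CF.1.
by apply: HL => //; exact: segment_norm.
Qed.

Lemma C1_lipschitz_rV (R : realType) (d n : nat)
    (F : R * 'rV[R]_d -> 'rV[R]_n) (t0 te B : R) :
  (forall i, Ck 1 (fun z => F z 0 i)) ->
  exists2 L, 0 <= L & forall t x y, t0 <= t <= te ->
    `|x| <= B -> `|y| <= B -> `|F (t, x) - F (t, y)| <= L * `|x - y|.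
Proof.
move=> CF; have /choice[M HM] : forall i, exists M, 0 <= M /\ forall t x y,
    t0 <= t <= te -> `|x| <= B -> `|y| <= B ->
    `|F (t, x) 0 i - F (t, y) 0 i| <= M * `|x - y|.
  by move=> i; have [M M0 HM] := C1_lipschitz t0 te B (CF i); exists M.
have S0 : 0 <= \sum_i M i by apply: sumr_ge0 => i _; case: (HM i).
exists (\sum_i M i) => // t x y tt xB yB.
apply: rV_norm_le => [|i]; first by rewrite mulr_ge0.
have [_ /(_ t x y tt xB yB)] := HM i; rewrite !mxE => /le_trans; apply.
rewrite ler_wpM2r// (bigD1 i)//= lerDl.
by apply: sumr_ge0 => j _; case: (HM j).
Qed.

Lemma Ck_entry (R : realType) (V : normedModType R) (n k : nat)
    (F : V -> 'rV[R]_n) i : Ck k F -> Ck k (fun z => F z 0 i).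
Proof.
elim: k F => [|k IH] F /=.
  move=> cF z; apply: (@continuous_comp _ _ _ F (fun x : 'rV[R]_n => x 0 i)).
    exact: cF.
  exact: coord_continuous.
move=> [dF HF]; split=> [z|v].
  apply: (@differentiable_comp _ _ _ _ F (fun x : 'rV[R]_n => x 0 i) z) => //.
  exact: differentiable_coord.
have -> : (fun x => 'D_v (fun z => F z 0 i) x) = (fun x => ('D_v F x) 0 i).
  by apply/funext => x; rewrite derive_mx ?mxE//; exact: diff_derivable.
exact: IH.
Qed.

(** * The flow near the exact solution *)

Lemma norm_rV_continuous (R : realType) (d : nat) :
  continuous (fun x : 'rV[R]_d => `|x|).
Proof. exact: norm_continuous. Qed.

(** The times at which c is reached form a compact set; it would have a least
    element, which the hypothesis excludes. *)
Lemma first_exit (R : realType) (g : R -> R) (a b c : R) :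
  {within `[a, b], continuous g} ->
  (forall s, a <= s <= b -> (forall s', a <= s' < s -> g s' < c) -> g s < c) ->
  forall s, a <= s <= b -> g s < c.
Proof.
move=> cg H s sab; rewrite ltNge; apply/negP => cgs.
have ab : a <= b by case/andP: sab; exact: le_trans.
pose E := `[a, b]%classic `&` (g \o clamp a b) @^-1` [set y | c <= y].
have cE : compact E.
  apply: compact_closedI; first exact: segment_compact.
  apply: preimage_closed; last exact: closed_ge.
  by move=> x _; exact: (continuous_clamp ab cg).
have E0 : E !=set0 by exists s; split=> /=; rewrite ?in_itv// clamp_id.
have [m] := @compact_EVT_min _ R id E E0 cE (continuous_subspaceT (fun x => cvg_id)).
rewrite inE => -[/=]; rewrite in_itv/= => mab; rewrite clamp_id// => cgm min.
suff : g m < c by rewrite ltNge cgm.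
apply: H => // s' /andP[a_s s'm]; rewrite ltNge; apply/negP => cgs'.
have s'ab : a <= s' <= b.
  by rewrite a_s (le_trans (ltW s'm))//; case/andP: mab.
have : s' \in E by rewrite inE; split=> /=; rewrite ?in_itv// clamp_id.
by move=> /min; rewrite leNgt s'm.
Qed.

Lemma solvesS (R : realType) (d : nat) (f : R -> 'rV[R]_d -> 'rV[R]_d)
    (a b c e : R) v : a <= c -> e <= b -> solves f a b v -> solves f c e v.
Proof.
move=> ac eb [cv Dv]; split; first exact: within_itvS cv.
move=> t /andP[ct te]; apply: Dv.
by rewrite (le_lt_trans ac ct) (lt_le_trans te eb).
Qed.

Lemma solves_eq (R : realType) (d : nat) (f g : R -> 'rV[R]_d -> 'rV[R]_d)
    (a b : R) v : (forall t, a < t < b -> f t (v t) = g t (v t)) ->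
  solves f a b v -> solves g a b v.
Proof.
by move=> fg [cv Dv]; split=> // t tab; rewrite -fg//; exact: Dv.
Qed.

Lemma solution_growth (R : realType) (d : nat)
    (f : R -> 'rV[R]_d -> 'rV[R]_d) (a b M : R) v : a <= b -> 0 <= M ->
  solves f a b v -> (forall t, a < t < b -> `|f t (v t)| <= M) ->
  `|v b - v a| <= M * (b - a).
Proof.
move=> ab M0 [cv Dv] fM.
exact: mean_value_inequality ab M0 cv Dv fM.
Qed.

(** Stability over a short interval.  Working with the maximum S of the distance
    between the two solutions replaces Gronwall's inequality: the mean value
    inequality gives S <= D + L h S, where D is the initial distance. *)
Lemma solution_stability (R : realType) (d : nat)
    (F : R -> 'rV[R]_d -> 'rV[R]_d) (L a h : R) v w :
  (forall t y z, `|F t y - F t z| <= L * `|y - z|) ->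
  0 < h -> 0 <= L -> L * h <= 2^-1 ->
  solves F a (a + h) v -> solves F a (a + h) w ->
  `|v (a + h) - w (a + h)| <= (1 + 2 * L * h) * `|v a - w a|.
Proof.
move=> FL h0 L0 Lh [cv Dv] [cw Dw]; have ah : a <= a + h by rewrite lerDl ltW.
pose D t := `|v t - w t|.
have cvw : {within `[a, a + h], continuous (fun t => v t - w t)}.
  by move=> t; apply: cvgB; [exact: cv|exact: cw].
have cD : {within `[a, a + h], continuous D}.
  exact: within_comp (@norm_rV_continuous _ _) cvw.
have [c cab Dc] := EVT_max ah cD; rewrite in_itv/= in cab.
have grow t : a <= t <= a + h -> D t <= D a + L * h * D c.
  move=> /andP[a_t th].
  have := @mean_value_inequality R d (fun t => v t - w t)
    (fun t => F t (v t) - F t (w t)) a t (L * D c) a_t.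
  move=> H; have {}H : `|v t - w t - (v a - w a)| <= L * D c * (t - a).
    apply: H; first by rewrite mulr_ge0// /D.
    - exact: within_itvS cvw.
    - move=> s /andP[a_s st]; have sab : a < s < a + h.
        by rewrite a_s (lt_le_trans st).
      by apply: is_deriveB; [exact: Dv|exact: Dw].
    - move=> s /andP[a_s st]; apply: (le_trans (FL _ _ _)).
      rewrite ler_wpM2l//; apply: Dc; rewrite in_itv/= ltW//= ltW//.
      exact: lt_le_trans st th.
  have : L * D c * (t - a) <= L * D c * h.
    by rewrite ler_wpM2l ?mulr_ge0 ?/D// lerBlDl.
  have := ler_normD (v t - w t - (v a - w a)) (v a - w a).
  by rewrite subrK -!/(D _); lra.
have Da0 : 0 <= D a by rewrite /D.
have Dc0 : 0 <= D c by rewrite /D.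
have Gc := grow c cab.
have : L * h * D c <= 2^-1 * D c by rewrite ler_wpM2r.
have [Lh0 Gb] : 0 <= L * h /\ D (a + h) <= D a + L * h * D c.
  by split; [rewrite mulr_ge0// ltW|apply: grow; rewrite ah/= lexx].
move=> Lc; have Dc2 : D c <= 2 * D a by lra.
have := ler_wpM2l Lh0 Dc2; rewrite -!/(D _); lra.
Qed.

(** The field frozen outside the slab and outside the box of radius B.  It is
    globally bounded and Lipschitz, so that solutions exist without any concern
    for where they go. *)
Definition truncate (R : realType) (d : nat) (F : R * 'rV[R]_d -> 'rV[R]_d)
    (t0 te B : R) (t : R) (x : 'rV[R]_d) : 'rV[R]_d :=
  F (clamp t0 te t, clip B x).

Lemma truncate_continuous (R : realType) (d : nat)
    (F : R * 'rV[R]_d -> 'rV[R]_d) (t0 te B : R) : continuous F ->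
  continuous (fun z : R * 'rV[R]_d => truncate F t0 te B z.1 z.2).
Proof.
move=> cF z; apply: (@continuous_comp _ _ _
  (fun z : R * 'rV[R]_d => (clamp t0 te z.1, clip B z.2)) F); last exact: cF.
apply: pair_continuous => y.
  apply: (@continuous_comp _ _ _ fst (clamp t0 te)); first exact: cvg_fst.
  exact: clamp_continuous.
apply: (@continuous_comp _ _ _ snd (@clip R d B)); first exact: cvg_snd.
exact: clip_continuous.
Qed.

Lemma truncate_bounds (R : realType) (d : nat)
    (F : R * 'rV[R]_d -> 'rV[R]_d) (t0 te B : R) : t0 <= te -> 0 <= B ->
  Ck 1 F -> exists M L, [/\ 0 <= M, 0 <= L,
    forall t x, `|truncate F t0 te B t x| <= M &
    forall t x y, `|truncate F t0 te B t x - truncate F t0 te B t y|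
      <= L * `|x - y|].
Proof.
move=> tt B0 CF.
have [M M0 HM] := bounded_on_box t0 te B (Ck_continuous CF).
have [L L0 HL] := C1_lipschitz_rV t0 te B (fun i => Ck_entry i CF).
exists M, L; split=> // [t x|t x y].
  by apply: HM; [exact: clamp_itv|exact: clip_norm].
have := HL (clamp t0 te t) (clip B x) (clip B y) (clamp_itv t tt)
  (clip_norm x B0) (clip_norm y B0).
by move=> /le_trans; apply; rewrite ler_wpM2l// clip_lip.
Qed.

Lemma solution_bounded (R : realType) (d : nat) (t0 te : R)
    (f : R -> 'rV[R]_d -> 'rV[R]_d) (u : R -> 'rV[R]_d) : t0 <= te ->
  solves f t0 te u ->
  exists2 B, 0 <= B & forall t, t0 <= t <= te -> `|u t| <= B.
Proof.
move=> tt [cu _]; have cn := within_comp (@norm_rV_continuous _ _) cu.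
have [c _ Hc] := EVT_max tt cn.
by exists `|u c| => // t t_in; apply: Hc; rewrite in_itv.
Qed.

(** The flow from a point near the exact solution.  Existence comes from the
    truncated field, whose solutions do not leave the box in a short time; that
    the solution selected in [flow] does not leave it either is the first-exit
    argument. *)
Lemma flow_near_solution (R : realType) (d : nat) (t0 te : R)
    (f : R -> 'rV[R]_d -> 'rV[R]_d) (u : R -> 'rV[R]_d) : t0 <= te ->
  Ck_slab t0 te 1 f -> solves f t0 te u ->
  exists L h0, [/\ 0 <= L, 0 < h0 & forall t h x, t0 <= t -> 0 < h <= h0 ->
    t + h <= te -> `|x - u t| <= 1 ->
    `|flow f t h x - u (t + h)| <= (1 + L * h) * `|x - u t|].
Proof.
move=> tt [F [CF Ff]] u_sol.
have [B0 B00 uB] := solution_bounded tt u_sol.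
(* Solutions start within 1 of u and move by at most 1/2 in a step of length h0,
   so they stay in the interior of the box of radius B0 + 2. *)
pose B := B0 + 2; have Bge0 : 0 <= B by rewrite addr_ge0.
have [M [L [M0 L0 FM FL]]] := truncate_bounds tt Bge0 CF.
have cT := @truncate_continuous _ _ _ t0 te B (Ck_continuous CF).
set T := truncate F t0 te B in FM FL cT.
have Tf t x : t0 <= t <= te -> `|x| <= B -> T t x = f t x.
  by move=> t_in xB; rewrite /T /truncate clamp_id// clip_id// Ff.
(* This makes both L h and M h at most 1/2. *)
pose h0 := (2 * (M + L + 1))^-1.
have ML : 0 < M + L + 1 by rewrite ltr_wpDl// addr_ge0.
have h0p : 0 < h0 by rewrite invr_gt0 mulr_gt0.
exists (2 * L), h0; split=> //; first by rewrite mulr_ge0.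
move=> t h x t0t /andP[hp hh0] the xu.
have Kh (K : R) : 0 <= K -> K <= M + L + 1 -> K * h <= 2^-1.
  move=> K0 KM; rewrite (le_trans (ler_wpM2l K0 hh0))//.
  by rewrite /h0 invfM mulrCA ler_piMr ?invr_ge0// ler_pdivrMr// mul1r.
have Lh : L * h <= 2^-1 by apply: Kh => //; lra.
have Mh : M * h <= 2^-1 by apply: Kh => //; lra.
have th : t <= t + h by rewrite lerDl ltW.
have in_slab s : t <= s <= t + h -> t0 <= s <= te.
  by move=> /andP[ts sth]; rewrite (le_trans t0t ts) (le_trans sth the).
have xB : `|x| <= B0 + 1.
  have := uB t; rewrite in_slab ?lexx// => /(_ isT).
  by have := ler_normD (x - u t) (u t); rewrite subrK; lra.
have Mle s : t <= s <= t + h -> M * (s - t) <= 2^-1.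
  by move=> /andP[ts sth]; rewrite (le_trans _ Mh)// ler_wpM2l// lerBlDl.
have subT v : solves T t (t + h) v -> v t = x ->
    forall s, t <= s <= t + h -> `|v s| <= B.
  move=> sv vt s sin; have /andP[ts sth] := sin.
  have := solution_growth ts M0 (solvesS (lexx t) sth sv) (fun r _ => FM r (v r)).
  have := Mle s sin; have := ler_normD (v s - v t) (v t).
  by rewrite subrK vt /B; lra.
have [v sv vt] := picard_existence t x cT FM FL hp L0 Lh.
have svf : solves f t (t + h) v.
  apply: (solves_eq _ sv) => s /andP[ts sth].
  have sin : t <= s <= t + h by rewrite !ltW.
  by rewrite Tf ?in_slab//; exact: subT sv vt s sin.
have [w [sw wt ww]] : [set y | exists v, [/\ solves f t (t + h) v, v t = x &
    v (t + h) = y]] (flow f t h x).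
  by rewrite /flow; apply: (@xgetPex _ _ [set y | _]); exists (v (t + h)), v.
have wB : forall s, t <= s <= t + h -> `|w s| < B.
  apply: first_exit.
    by have [cw _] := sw; exact: within_comp (@norm_rV_continuous _ _) cw.
  move=> s sin H; have /andP[ts sth] := sin.
  have wf r : t < r < s -> `|f r (w r)| <= M.
    move=> /andP[tr rs]; rewrite -Tf//.
      by apply: in_slab; rewrite !ltW// (lt_le_trans rs).
    by apply/ltW/H; rewrite ltW.
  have := solution_growth ts M0 (solvesS (lexx t) sth sw) wf.
  have := Mle s sin; have := ler_normD (w s - w t) (w t).
  by rewrite subrK wt /B; lra.
have swT : solves T t (t + h) w.
  apply: (solves_eq _ sw) => s /andP[ts sth].
  have sin : t <= s <= t + h by rewrite !ltW.
  by rewrite Tf ?in_slab//; exact/ltW/wB.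
have suT : solves T t (t + h) u.
  apply: (solves_eq _ (solvesS t0t the u_sol)) => s /andP[ts sth].
  have sin : t <= s <= t + h by rewrite !ltW.
  rewrite Tf ?in_slab// (le_trans (uB _ (in_slab _ sin)))//.
  by rewrite /B lerDl.
by rewrite -ww -wt; exact: solution_stability FL hp L0 Lh swT suT.
Qed.

(** * Accuracy of one step of a scheme *)

(** Stands for the choice of a step size bound that is as small as finitely many
    conditions require. *)
Lemma small_below (R : realType) (s : seq R) : all (fun c => 0 < c) s ->
  exists2 e, 0 < e & all (fun c => e <= c) s.
Proof.
elim: s => [|c s IH] /=; first by exists 1.
move=> /andP[c0 /IH[e e0 es]]; exists (Num.min c e).
  by rewrite lt_min c0 e0.
rewrite ge_min lexx/=; apply: sub_all es => z ez.
by rewrite (le_trans _ ez)// ge_min lexx orbT.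
Qed.

(** A version of Heine's theorem in which only one of the two points has to lie
    in the compact set, as is needed for perturbations of a trajectory.  The
    local radii of continuity are made uniform by covering compactness. *)
Lemma uniform_continuity_at_compact (R : realType) (X W : normedModType R)
    (g : X -> W) (K : set X) (e : R) : continuous g -> compact K -> 0 < e ->
  exists2 r, 0 < r & forall y z, K y -> `|z - y| < r -> `|g z - g y| < e.
Proof.
move=> cg cK e0; pose P (r : R) (y : X) := forall z, `|z - y| < r -> `|g z - g y| < e.
have cov : forall y, K y -> \forall y' \near y & r \near 0^'+, P r y'.
  move=> y _; have e20 : 0 < e / 2 by rewrite divr_gt0.
  have /cvgrPdist_lt/(_ _ e20)/nbhs_normP[r /= r0 Hr] := cg y.
  have Hr' z : `|z - y| < r -> `|g y - g z| < e / 2.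
    by rewrite distrC => zy; exact: Hr.
  exists (ball y (r / 2), [set q | q < r / 2]).
    split=> /=; first by apply: nbhsx_ballx; rewrite divr_gt0.
    by apply: nbhs_right_lt; rewrite divr_gt0.
  move=> [y' q] /= [+ qr] z zy'; rewrite -ball_normE/= distrC => y'y.
  have zy : `|z - y| < r by have := ler_distD y' z y; lra.
  have y'y2 : `|y' - y| < r by apply: lt_trans y'y _; lra.
  have := Hr' z zy; have := Hr' y' y'y2; have := ler_distD (g y) (g z) (g y').
  by rewrite (distrC (g z) (g y)); lra.
have /compact_near_coveringP/(_ R (0^'+) P _ cov) H := cK.
near (0 : R)^'+ => r; exists r; first by [].
have Hr : K `<=` P r by near: r.
by move=> y z Ky; exact: Hr.
Unshelve. all: by end_near. Qed.

Lemma clamp_slab_continuous (R : realType) (V W : normedModType R) (t0 te : R)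
    (phi : R -> V -> W) : t0 <= te ->
  {within `[t0, te] `*` setT, continuous (fun z : R * V => phi z.1 z.2)} ->
  continuous (fun z : R * V => phi (clamp t0 te z.1) z.2).
Proof.
move=> tt /subspace_continuousP cphi z.
have := cphi (clamp t0 te z.1, z.2); rewrite /= in_itv/= clamp_itv//.
move=> /(_ (conj isT I)) h.
pose c (z : R * V) := (clamp t0 te z.1, z.2).
have cc : continuous c.
  apply: pair_continuous => y; last exact: cvg_snd.
  apply: (@continuous_comp _ _ _ fst (clamp t0 te)); first exact: cvg_fst.
  exact: clamp_continuous.
apply: (@cvg_comp _ _ _ c (fun z => phi z.1 z.2) (nbhs z)
  (within (`[t0, te] `*` setT) (nbhs (c z))) _ _ h) => A /=.
rewrite /within/= => wA; have := cc z _ wA; rewrite /= nbhs_simpl/=.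
apply: filterS => s; apply.
by split=> //=; rewrite in_itv/= clamp_itv.
Qed.

(** The principal error is a limit, hence unique, but only for t < te; this is
    all that steps inside [t0, te] can see. *)
Lemma principal_error_unique (R : realType) (d : nat)
    (f : R -> 'rV[R]_d -> 'rV[R]_d) (t0 te : R) (N : scheme R d) (p : nat)
    phi psi : principal_error f t0 te N p phi ->
  principal_error f t0 te N p psi ->
  forall t x, t0 <= t < te -> phi t x = psi t x.
Proof.
move=> [phiP _] [psiP _] t x t_in.
by apply: cvg_unique (phiP t x t_in) (psiP t x t_in).
Qed.

(** Consistency and stability of one step in a single estimate.  Comparison with
    u(t + h) instead of the flow from (t, x) keeps the flow out of the
    propagation of errors. *)
Definition step_accuracy (R : realType) (d : nat) (t0 te : R)
    (u : R -> 'rV[R]_d) (N : scheme R d) (k : nat) (C h0 : R) : Prop :=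
  forall t h x, t0 <= t -> 0 < h <= h0 -> t + h <= te -> `|x - u t| <= 1 ->
    `|N t h x - u (t + h)| <= (1 + C * h) * `|x - u t| + C * h ^+ k.+1.

Lemma step_accuracy_le (R : realType) (d : nat) (t0 te : R)
    (u : R -> 'rV[R]_d) (N : scheme R d) (k : nat) (C C' h0 h0' : R) :
  C <= C' -> h0' <= h0 -> step_accuracy t0 te u N k C h0 ->
  step_accuracy t0 te u N k C' h0'.
Proof.
move=> CC hh H t h x t0t /andP[hp hh'] the xu.
have hh0 : 0 < h <= h0 by rewrite hp (le_trans hh').
apply: (le_trans (H t h x t0t hh0 the xu)).
by rewrite lerD ?ler_wpM2r ?exprn_ge0 ?lerD2l ?ler_wpM2r// ltW.
Qed.

Lemma order_step_accuracy (R : realType) (d : nat) (t0 te : R)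
    (f : R -> 'rV[R]_d -> 'rV[R]_d) (u : R -> 'rV[R]_d) (N : scheme R d)
    (k : nat) : t0 <= te -> Ck_slab t0 te 1 f -> solves f t0 te u ->
  has_order f t0 te N k ->
  exists C h0, [/\ 0 <= C, 0 < h0 & step_accuracy t0 te u N k C h0].
Proof.
move=> tt fC u_sol [phi [[_ cphi] HN]].
have [L [h1 [L0 h1p HL]]] := flow_near_solution tt fC u_sol.
have [B B0 uB] := solution_bounded tt u_sol.
have cphi' := clamp_slab_continuous tt cphi.
have [M M0 phiM] := bounded_on_box t0 te (B + 1) cphi'.
have [C [h2 [h2p HC]]] := HN _ (@ball_rV_compact R d (B + 1)).
have [h0 h0p /= /and3P[h01 h02 _]] : exists2 h0, 0 < h0 &
    all (fun c => h0 <= c) [:: h1; h2] by apply: small_below; rewrite /= h1p h2p.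
have T0 : 0 <= L + M + `|C| * h2 by rewrite !addr_ge0 ?mulr_ge0// ltW.
exists (L + M + `|C| * h2), h0; split=> // t h x t0t /andP[hp hh0] the xu.
have t_in : t0 <= t <= te by rewrite t0t (le_trans _ the)// lerDl ltW.
have xB : `|x| <= B + 1.
  by have := uB t t_in; have := ler_normD (x - u t) (u t); rewrite subrK; lra.
have hh1 : 0 < h <= h1 by rewrite hp (le_trans hh0).
have hh2 : 0 < h <= h2 by rewrite hp (le_trans hh0).
have H1 := HL t h x t0t hh1 the xu.
have H2 := HC t h x t0t hh2 the xB.
have := phiM t x t_in xB; rewrite /= clamp_id// => H3.
have hk0 : 0 <= h ^+ k.+1 by rewrite exprn_ge0// ltW.
have H4 : `|h ^+ k.+1 *: phi t x| <= M * h ^+ k.+1.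
  by rewrite normrZ ger0_norm// mulrC ler_wpM2r.
have H5 : C * h ^+ k.+2 <= `|C| * h2 * h ^+ k.+1.
  have hk2 : 0 <= h ^+ k.+2 by rewrite exprn_ge0// ltW.
  rewrite (le_trans (ler_wpM2r hk2 (ler_norm C)))// -mulrA ler_wpM2l//.
  by rewrite exprS ler_wpM2r//; case/andP: hh2.
have -> : N t h x - u (t + h) = (N t h x - flow f t h x - h ^+ k.+1 *: phi t x)
    + h ^+ k.+1 *: phi t x + (flow f t h x - u (t + h)).
  by rewrite subrK addrA subrK.
apply: (le_trans (ler_normD _ _)).
have H6 := ler_normD (N t h x - flow f t h x - h ^+ k.+1 *: phi t x)
  (h ^+ k.+1 *: phi t x).
have H7 : (1 + L * h) * `|x - u t| <= (1 + (L + M + `|C| * h2) * h) * `|x - u t|.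
  rewrite ler_wpM2r// lerD2l; apply: ler_wpM2r; first exact: ltW.
  have : 0 <= `|C| * h2 by rewrite mulr_ge0// ltW.
  lra.
have : 0 <= L * h ^+ k.+1 by rewrite mulr_ge0.
lra.
Qed.

(** * The error estimator *)

Lemma slope_linear (R : realType) (d : nat) (F : R * 'rV[R]_d -> R) z (a : R)
    (v w : 'rV[R]_d) : slope F z (a *: v + w) = a * slope F z v + slope F z w.
Proof.
rewrite /slope mulr_sumr -big_split; apply: eq_bigr => i _ /=.
by rewrite !mxE mulrDl mulrA.
Qed.

Lemma sum_continuous (R : realType) (V : normedModType R) (n : nat)
    (F : 'I_n -> V -> R) : (forall i, continuous (F i)) ->
  continuous (fun z => \sum_i F i z).
Proof.
elim: n F => [|n IH] F cF z.
  by under eq_fun do rewrite big_ord0; exact: cvg_cst.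
under eq_fun do rewrite big_ord_recr/=.
by apply: cvgD; [exact: IH|exact: cF].
Qed.

Lemma slope_continuous (R : realType) (d : nat) (V : normedModType R)
    (F : R * 'rV[R]_d -> R) (c : V -> R * 'rV[R]_d) (w : V -> 'rV[R]_d) :
  Ck 1 F -> continuous c -> continuous w ->
  continuous (fun z => slope F (c z) (w z)).
Proof.
move=> [_ CF] cc cw; apply: sum_continuous => i z.
apply: cvgM.
  apply: (@continuous_comp _ _ _ w (fun x : 'rV[R]_d => x 0 i)); first exact: cw.
  exact: coord_continuous.
by apply: (@continuous_comp _ _ _ c ('D_(0, delta_mx 0 i) F));
  [exact: cc|exact: CF].
Qed.

(** The error of the scheme of higher order p > phat and the remainder of the
    other one are both O(h^(phat + 2)), so the difference of the two
    schemes exposes the principal error phi. *)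
Lemma scheme_difference (R : realType) (d : nat) (t0 te : R)
    (f : R -> 'rV[R]_d -> 'rV[R]_d) (N Nminus : scheme R d) (p phat : nat)
    (phi : R -> 'rV[R]_d -> 'rV[R]_d) (B : R) : t0 <= te -> (phat < p)%N ->
  has_order f t0 te N p -> has_order f t0 te Nminus phat ->
  principal_error f t0 te Nminus phat phi ->
  exists C h0, [/\ 0 <= C, 0 < h0 & forall t h x, t0 <= t -> 0 < h <= h0 ->
    t + h <= te -> `|x| <= B ->
    `|Nminus t h x - N t h x - h ^+ phat.+1 *: phi t x| <= C * h ^+ phat.+2].
Proof.
move=> tt php [psi [[_ cpsi] HN]] [phi' [phi'P HNm]] phiP.
have cpsi' := clamp_slab_continuous tt cpsi.
have [M M0 psiM] := bounded_on_box t0 te B cpsi'.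
have cB := @ball_rV_compact R d B.
have [C1 [h1 [h1p HC1]]] := HN _ cB.
have [C2 [h2 [h2p HC2]]] := HNm _ cB.
have [h0 h0p /= /and4P[h01 h02 h03 _]] : exists2 h0, 0 < h0 &
    all (fun c => h0 <= c) [:: h1; h2; 1].
  by apply: small_below; rewrite /= h1p h2p ltr01.
exists (`|C1| + `|C2| + M), h0; split=> //; first by rewrite !addr_ge0.
move=> t h x t0t /andP[hp hh0] the xB.
have t_in : t0 <= t <= te by rewrite t0t (le_trans _ the)// lerDl ltW.
have t_in' : t0 <= t < te by rewrite t0t (lt_le_trans _ the)// ltrDl.
have hh1 : 0 < h <= h1 by rewrite hp (le_trans hh0).
have hh2 : 0 < h <= h2 by rewrite hp (le_trans hh0).
have hle1 : h <= 1 by apply: le_trans hh0 h03.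
have := HC1 t h x t0t hh1 the xB; have := HC2 t h x t0t hh2 the xB.
rewrite -(principal_error_unique phiP phi'P)//.
have := psiM t x t_in xB; rewrite /= clamp_id// => H3.
have hq0 k : 0 <= h ^+ k by rewrite exprn_ge0// ltW.
have hq k : (phat.+2 <= k)%N -> h ^+ k <= h ^+ phat.+2.
  by move=> hk; rewrite ler_wiXn2l// ltW.
have H4 : `|h ^+ p.+1 *: psi t x| <= M * h ^+ phat.+2.
  rewrite normrZ ger0_norm// mulrC; apply: ler_pM => //.
  exact: hq.
have H5 : C1 * h ^+ p.+2 <= `|C1| * h ^+ phat.+2.
  rewrite (le_trans (ler_wpM2r (hq0 _) (ler_norm C1)))// ler_wpM2l// hq//.
  exact: ltnW.
have H6 : C2 * h ^+ phat.+2 <= `|C2| * h ^+ phat.+2.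
  exact: (ler_wpM2r (hq0 _) (ler_norm C2)).
set y := flow f t h x; set a := h ^+ phat.+1 *: phi t x.
set b := h ^+ p.+1 *: psi t x in H4 *; move=> H2 H1.
have -> : Nminus t h x - N t h x - a =
    (Nminus t h x - y - a) - (N t h x - y - b) - b.
  apply/rowP => i; rewrite !mxE; ring.
have := ler_normB (Nminus t h x - y - a - (N t h x - y - b)) b.
have := ler_normB (Nminus t h x - y - a) (N t h x - y - b).
lra.
Qed.

Lemma pair_norm_lt (R : realType) (V W : normedModType R) (x : V * W) (r : R) :
  `|x.1| < r -> `|x.2| < r -> `|x| < r.
Proof. by move=> x1 x2; rewrite prod_normE gt_max x1. Qed.

Lemma solution_uniformly_continuous (R : realType) (d : nat) (t0 te e : R)
    (f : R -> 'rV[R]_d -> 'rV[R]_d) (u : R -> 'rV[R]_d) : t0 <= te ->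
  solves f t0 te u -> 0 < e ->
  exists2 r, 0 < r & forall t s, t0 <= t <= te -> t0 <= s <= te ->
    `|s - t| < r -> `|u s - u t| < e.
Proof.
move=> tt [cu _] e0.
have [r r0 Hr] := uniform_continuity_at_compact (continuous_clamp tt cu)
  (@segment_compact _ t0 te) e0.
exists r => // t s t_in s_in st; have := Hr t s.
by rewrite /= in_itv/= !clamp_id//; exact.
Qed.

(** The slope of the integrand in the direction of the principal error is a
    continuous function of a pair of points of space-time, (t', y) for the slope
    and (t, x) for the principal error; the trajectory enters as the compact
    curve ((t, u(t)), (t, u(t))). *)
Lemma slope_along_trajectory (R : realType) (d : nat) (t0 te e : R)
    (f : R -> 'rV[R]_d -> 'rV[R]_d) (u : R -> 'rV[R]_d)
    (G : R * 'rV[R]_d -> R) (phi : R -> 'rV[R]_d -> 'rV[R]_d) : t0 <= te ->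
  solves f t0 te u -> Ck 1 G ->
  {within `[t0, te] `*` setT,
    continuous (fun z : R * 'rV[R]_d => phi z.1 z.2)} -> 0 < e ->
  (exists2 r, 0 < r & forall t t' y x, t0 <= t <= te -> `|t' - t| < r ->
    `|y - u t| < r -> `|x - u t| < r ->
    `|slope G (t', y) (phi t x) - slope G (t, u t) (phi t (u t))| < e) /\
  (exists M, forall t, t0 <= t <= te -> `|slope G (t, u t) (phi t (u t))| <= M).
Proof.
move=> tt [cu _] CG cphi0 e0.
pose U := u \o clamp t0 te; have cU : continuous U by exact: continuous_clamp.
have cphi := clamp_slab_continuous tt cphi0.
pose X : normedModType R := ((R * 'rV[R]_d) * (R * 'rV[R]_d))%type.
pose psi (z : X) := slope G z.1 (phi (clamp t0 te z.2.1) z.2.2).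
have cpsi : continuous psi.
  apply: slope_continuous => //; first by move=> z; exact: cvg_fst.
  move=> z; apply: (@continuous_comp _ _ _ snd
    (fun z : R * 'rV[R]_d => phi (clamp t0 te z.1) z.2)); first exact: cvg_snd.
  exact: cphi.
pose gam (t : R) : X := ((t, U t), (t, U t)).
have cgam : continuous gam.
  by apply: pair_continuous; apply: pair_continuous => // t; exact: cvg_id.
have psigam t : t0 <= t <= te ->
    psi (gam t) = slope G (t, u t) (phi t (u t)).
  by move=> t_in; rewrite /psi /gam /U /= !clamp_id.
split.
  have cK : compact (gam @` `[t0, te]).
    apply: continuous_compact; last exact: segment_compact.
    exact: continuous_subspaceT.
  have [r r0 Hr] := uniform_continuity_at_compact cpsi cK e0.
  exists r => // t t' y x t_in t't yu xu.
  rewrite -psigam//; have := Hr (gam t) ((t', y), (t, x)).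
  rewrite /psi [X in phi X _]/= clamp_id//; apply.
    by exists t => //=; rewrite in_itv.
  apply: pair_norm_lt; apply: pair_norm_lt => /=; rewrite /U /= ?clamp_id//.
  by rewrite subrr normr0.
have cabs : continuous (fun t => `|psi (gam t)|).
  move=> t; apply: (@continuous_comp _ _ _ (psi \o gam) (fun x : R => `|x|)).
    by apply: continuous_comp; [exact: cgam|exact: cpsi].
  exact: norm_continuous.
have [c _ Hc] := EVT_max tt (continuous_subspaceT cabs).
exists `|psi (gam c)| => t t_in; rewrite -psigam//.
by apply: Hc; rewrite in_itv.
Qed.

Lemma perturbed_product_bounds (R : realType) (m M q c P S : R) :
  0 <= q -> m <= `|c| -> `|c| <= M -> `|P - c| < m / 4 -> `|S| <= m / 4 * q ->
  m / 2 * q <= `|q * P + S| <= (M + m / 2) * q.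
Proof.
move=> q0 mc cM Pc Sq.
have HP1 : `|P| <= M + m / 4.
  by have := ler_normD (P - c) c; rewrite subrK; lra.
have HP2 : 3 / 4 * m <= `|P|.
  by have := ler_normB P (P - c); rewrite opprB addrC subrK; lra.
have H3 : `|q * P| = q * `|P| by rewrite normrM ger0_norm.
have H4 := ler_wpM2l q0 HP1; have H5 := ler_wpM2l q0 HP2.
have H6 := ler_normD (q * P) S; have H7 := ler_normB (q * P + S) S.
have mq : 0 <= m / 4 * q by exact: le_trans Sq.
by rewrite addrK in H7; apply/andP; split; lra.
Qed.

Lemma step_stays_close (R : realType) (C1 C h e x y : R) k :
  0 <= C1 <= C -> 0 < h <= e -> e <= 1 -> 0 <= x <= e ->
  y <= (1 + C1 * h) * x + C1 * h ^+ k.+1 -> y <= (1 + 2 * C) * e.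
Proof.
move=> /andP[C10 C1C] /andP[hp he] e1 /andP[x0 xe] /le_trans; apply.
have h1 : h <= 1 := le_trans he e1; have h0 := ltW hp.
have hk : h ^+ k.+1 <= h by rewrite exprS ler_piMr//; exact: exprn_ile1.
have H1 : C1 * h ^+ k.+1 <= C * e.
  by apply: ler_pM => //; [exact: exprn_ge0|exact: le_trans he].
have H2 : (1 + C1 * h) * x <= (1 + C) * e.
  apply: ler_pM => //; first by rewrite addr_ge0// mulr_ge0.
  by rewrite lerD2l (le_trans _ C1C)// ler_piMr.
lra.
Qed.

(** The estimate behaves like h^q |dj/du phi|, q the order of the lower-order
    scheme plus one: by the mean value theorem it is the slope of j, at a point
    close to the trajectory, in the direction of the difference of the two
    schemes, whose leading term is h^q phi. *)
Lemma estimator_bounds (R : realType) (d : nat) (t0 te : R)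
    (f : R -> 'rV[R]_d -> 'rV[R]_d) (j : R -> 'rV[R]_d -> R)
    (u : R -> 'rV[R]_d) (N Nminus : scheme R d) (p phat : nat)
    (phi : R -> 'rV[R]_d -> 'rV[R]_d) (m : R) : t0 <= te -> (phat < p)%N ->
  Ck_slab t0 te 1 f -> Ck_slab t0 te 1 j -> solves f t0 te u ->
  has_order f t0 te N p -> has_order f t0 te Nminus phat ->
  principal_error f t0 te Nminus phat phi -> 0 < m ->
  (forall t, t0 <= t <= te -> m <= `|'d (j t) (u t) (phi t (u t))|) ->
  exists M e, [/\ 0 < M, 0 < e & forall t h x, t0 <= t -> 0 < h <= e ->
    t + h <= te -> `|x - u t| <= e ->
    m / 2 * h ^+ phat.+1 <= `|estimate j N Nminus t h x| <= M * h ^+ phat.+1].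
Proof.
move=> tt php fC [G [CG Gj]] u_sol HN HNm phiP m0 ctrl.
have [B B0 uB] := solution_bounded tt u_sol.
have [C1 [h1 [C10 h1p HC1]]] := order_step_accuracy tt fC u_sol HN.
have [C2 [h2 [C20 h2p HC2]]] := order_step_accuracy tt fC u_sol HNm.
have [C3 [h3 [C30 h3p HC3]]] := scheme_difference (B + 1) tt php HN HNm phiP.
have [L L0 HL] := slope_le t0 te (B + 1) CG.
have m40 : 0 < m / 4 by rewrite divr_gt0.
have [_ cphi] := phiP.
have [[r0 r0p Hr0] [M2 HM2]] := slope_along_trajectory tt u_sol CG cphi m40.
have r020 : 0 < r0 / 2 by rewrite divr_gt0.
have r042 : r0 / 4 <= r0 / 2 by lra.
have [r1 r1p Hr1] := solution_uniformly_continuous tt u_sol r020.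
have [C C1C C2C] : exists2 C, 0 <= C1 <= C & 0 <= C2 <= C.
  by exists (C1 + C2); rewrite ?C10 ?C20/= ?lerDl ?lerDr.
have Cp : 0 < 1 + 2 * C by case/andP: C1C; lra.
have LC : 0 < L * C3 + 1 by rewrite ltr_wpDl// mulr_ge0.
have [e e0 /= /and5P[eh1 eh2 eh3 e1 /and5P[er1 er0 eC eCr /andP[eLC _]]]] :
    exists2 e, 0 < e & all (fun c => e <= c) [:: h1; h2; h3; 1; r1 / 2; r0 / 2;
      (1 + 2 * C)^-1; (1 + 2 * C)^-1 * (r0 / 4); m / 4 / (L * C3 + 1)].
  have iC : 0 < (1 + 2 * C)^-1 by rewrite invr_gt0.
  have [r04 r12] : 0 < r0 / 4 /\ 0 < r1 / 2 by rewrite !divr_gt0.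
  apply: small_below; rewrite /= h1p h2p h3p ltr01 r12 r020 iC/=.
  by rewrite mulr_gt0// divr_gt0.
(* The values of both schemes, hence the whole segment between them, are within
   (1 + 2 C) e of u(t + h). *)
have Ce1 : (1 + 2 * C) * e <= 1 by rewrite -ler_pdivlMl// mulr1.
have Cer : (1 + 2 * C) * e <= r0 / 4 by rewrite -ler_pdivlMl.
exists (`|M2| + m / 2), e; split=> //; first by rewrite ltr_wpDl// divr_gt0.
move=> t h x t0t /andP[hp he] the xu; have h0 := ltW hp.
have t_in : t0 <= t <= te by rewrite t0t (le_trans _ the)// lerDl.
have th_in : t0 <= t + h <= te by rewrite the (le_trans t0t)// lerDl.
have hin c' : e <= c' -> 0 < h <= c' by rewrite hp; exact: le_trans.
have xu1 : `|x - u t| <= 1 by exact: le_trans xu e1.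
have xue : 0 <= `|x - u t| <= e by rewrite normr_ge0.
have Hb := step_stays_close C1C (hin _ (lexx e)) e1 xue
  (HC1 t h x t0t (hin _ eh1) the xu1).
have Ha := step_stays_close C2C (hin _ (lexx e)) e1 xue
  (HC2 t h x t0t (hin _ eh2) the xu1).
have near_le (y v : 'rV[R]_d) c : `|v| <= B -> `|y - v| <= c -> c <= 1 ->
    `|y| <= B + 1.
  by move=> vB yv c1; rewrite -(subrK v y) (le_trans (ler_normD _ _))// addrC
    lerD// (le_trans yv).
have xB := near_le _ _ _ (uB t t_in) xu e1.
have Hd := HC3 t h x t0t (hin _ eh3) the xB.
rewrite /estimate -!Gj//; set a := Nminus t h x in Ha Hd *.
set b := N t h x in Hb Hd *.
have [s s01 ->] := mean_value_slope (t + h) a b CG.1.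
set xi := b + s *: (a - b).
have Hxi : `|xi - u (t + h)| <= (1 + 2 * C) * e.
  have -> : xi - u (t + h) = (b - u (t + h)) +
      s *: ((a - u (t + h)) - (b - u (t + h))).
    by rewrite /xi opprB addrA subrK addrAC.
  exact: segment_norm.
have xiB := near_le _ _ _ (uB _ th_in) Hxi Ce1.
have htt : `|t + h - t| = h by rewrite addrC addKr gtr0_norm.
have half (c : R) : 0 < c -> c / 2 < c.
  by move=> c0; rewrite ltr_pdivrMr// ltr_pMr// ltr1n.
have uu : `|u (t + h) - u t| < r0 / 2.
  by apply: Hr1 => //; rewrite htt (le_lt_trans he)// (le_lt_trans er1)// half.
have er0' : e < r0 by rewrite (le_lt_trans er0)// half.
have Hpsi : `|slope G (t + h, xi) (phi t x) - slope G (t, u t) (phi t (u t))|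
    < m / 4.
  apply: Hr0 => //; first by rewrite htt (le_lt_trans he).
  - rewrite (le_lt_trans (ler_distD (u (t + h)) _ _))// [ltRHS]splitr.
    by rewrite ler_ltD// (le_trans Hxi)// (le_trans Cer).
  - by rewrite (le_lt_trans xu).
have Hm := ctrl t t_in.
have dj : 'd (j t) (u t) (phi t (u t)) = slope G (t, u t) (phi t (u t)).
  rewrite -slope_differential; last exact: CG.1.
  by congr ('d _ _ _); apply/funext => y; rewrite Gj.
rewrite dj in Hm; have HM := le_trans (HM2 t t_in) (ler_norm M2).
have q0 : 0 <= h ^+ phat.+1 by rewrite exprn_ge0.
have -> : a - b = h ^+ phat.+1 *: phi t x + (a - b - h ^+ phat.+1 *: phi t x).
  by rewrite subrKC.
rewrite slope_linear; apply: perturbed_product_bounds Hpsi _ => //.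
apply: (le_trans (HL _ _ _ th_in xiB)); apply: (le_trans (ler_wpM2l L0 Hd)).
rewrite (exprS h phat.+1) mulrA mulrA ler_wpM2r//.
apply: (@le_trans _ _ ((L * C3 + 1) * e)); last by rewrite mulrC -ler_pdivlMr.
by apply: ler_pM => //; [exact: mulr_ge0|rewrite lerDl].
Qed.

(** * Quadrature along the exact solution *)

Lemma Ck_add (R : realType) (V : normedModType R) k (F G : V -> R) :
  Ck k F -> Ck k G -> Ck k (fun x => F x + G x).
Proof.
elim: k F G => [|k IH] F G /=.
  by move=> cF cG x; apply: cvgD; [exact: cF|exact: cG].
move=> [dF HF] [dG HG]; split=> [x|v]; first exact: differentiableD.
have -> : (fun x => 'D_v (fun y => F y + G y) x) =
    (fun x => 'D_v F x + 'D_v G x).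
  by apply/funext => x; rewrite deriveD//; exact: diff_derivable.
exact: IH.
Qed.

Lemma Ck_mul (R : realType) (V : normedModType R) k (F G : V -> R) :
  Ck k F -> Ck k G -> Ck k (fun x => F x * G x).
Proof.
elim: k F G => [|k IH] F G CF CG.
  by move=> x; apply: cvgM; [exact: CF|exact: CG].
have [[dF HF] [dG HG]] := (CF, CG).
split=> [x|v]; first exact: differentiableM.
have -> : (fun x => 'D_v (fun y => F y * G y) x) =
    (fun x => F x * 'D_v G x + G x * 'D_v F x).
  by apply/funext => x; rewrite deriveM//; exact: diff_derivable.
apply: Ck_add; apply: IH; [|exact: HG| |exact: HF].
  exact: Ck_le (leqnSn k) CF.
exact: Ck_le (leqnSn k) CG.
Qed.

Lemma Ck_cst (R : realType) (V : normedModType R) k (c : R) :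
  Ck k (fun _ : V => c).
Proof.
elim: k c => [|k IH] c /=; first by move=> x; exact: cvg_cst.
split=> [x|v]; first exact: differentiable_cst.
have -> : (fun x => 'D_v (fun _ : V => c) x) = (fun=> 0 : R).
  by apply/funext => x; exact: derive_cst.
exact: IH.
Qed.

Lemma Ck_sum (R : realType) (V : normedModType R) k n (F : 'I_n -> V -> R) :
  (forall i, Ck k (F i)) -> Ck k (fun x => \sum_i F i x).
Proof.
elim: n F => [|n IH] F CF.
  under eq_fun do rewrite big_ord0; exact: Ck_cst.
under eq_fun do rewrite big_ord_recr /=.
by apply: Ck_add => //; exact: IH.
Qed.

(** The total time derivative along solutions of the differential equation with
    right-hand side f.  Its iterates give the derivatives of t |-> F(t, u(t)) as
    functions of (t, u(t)). *)
Definition along_field (R : realType) (d : nat) (f : R * 'rV[R]_d -> 'rV[R]_d)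
    (F : R * 'rV[R]_d -> R) (z : R * 'rV[R]_d) : R :=
  'D_(1, 0) F z + slope F z (f z).

Lemma Ck_along_field (R : realType) (d k : nat)
    (f : R * 'rV[R]_d -> 'rV[R]_d) (F : R * 'rV[R]_d -> R) :
  Ck k f -> Ck k.+1 F -> Ck k (along_field f F).
Proof.
move=> Cf [_ CF]; apply: Ck_add; first exact: CF.
by apply: Ck_sum => i; apply: Ck_mul; [exact: Ck_entry|exact: CF].
Qed.

Lemma Ck_iter_along_field (R : realType) (d r i : nat)
    (f : R * 'rV[R]_d -> 'rV[R]_d) (F : R * 'rV[R]_d -> R) :
  (i <= r)%N -> Ck r f -> Ck r F -> Ck (r - i) (iter i (along_field f) F).
Proof.
move=> + Cf CF; elim: i => [|i IH] ir; first by rewrite subn0.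
apply: Ck_along_field; first by apply: Ck_le Cf; exact: leq_subr.
by rewrite -subSn//= subSS; apply: IH; exact: ltnW.
Qed.

Lemma is_derive_along_field (R : realType) (d : nat)
    (f : R * 'rV[R]_d -> 'rV[R]_d) (F : R * 'rV[R]_d -> R)
    (u : R -> 'rV[R]_d) (t : R) : differentiable F (t, u t) ->
  is_derive t 1 u (f (t, u t)) ->
  is_derive t 1 (fun s => F (s, u s)) (along_field f F (t, u t)).
Proof.
move=> dF Du; have -> : along_field f F (t, u t) = 'd F (t, u t) (1, f (t, u t)).
  rewrite /along_field slopeE// deriveE// -linearD; congr ('d F _ _).
  by congr pair => /=; rewrite ?addr0 ?add0r.
apply: (is_derive_along (c := fun s => (s, u s)) dF).
by apply: is_derive_pair => //; exact: is_derive_id.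
Qed.

(** Along the solution the integrand is as smooth as the data, its derivatives
    being continuous functions of (t, u(t)); hence the quadrature error of one
    step has a uniform constant. *)
Lemma quadrature_error (R : realType) (d s r : nat) (t0 te : R)
    (f : R -> 'rV[R]_d -> 'rV[R]_d) (j : R -> 'rV[R]_d -> R)
    (u : R -> 'rV[R]_d) (gamma sigma : 'I_s.+1 -> R) : t0 <= te ->
  Ck_slab t0 te r f -> Ck_slab t0 te r j -> solves f t0 te u ->
  (forall k, 0 <= gamma k <= 1) -> quadrature_order gamma sigma r ->
  exists2 C, 0 <= C & forall a h, t0 <= a -> 0 < h -> a + h <= te ->
    `|\int[lebesgue_measure]_(t in `[a, a + h]) j t (u t)
      - h * \sum_(k < s.+1) sigma k * j (a + gamma k * h) (u (a + gamma k * h))|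
    <= C * h ^+ r.+1.
Proof.
move=> tt [F [CF Ff]] [G [CG Gj]] [cu Du] gam01 [C HC].
pose g i t := iter i (along_field F) G (t, u t).
have Cg i : (i <= r)%N -> Ck (r - i) (iter i (along_field F) G).
  by move=> ir; exact: Ck_iter_along_field.
have cg i : (i <= r)%N -> {within `[t0, te], continuous (g i)}.
  move=> ir; apply: (@within_comp _ _ _ _ (fun t => (t, u t))).
    exact: Ck_continuous (Cg i ir).
  apply: (@pair_continuous (subspace `[t0, te]) R _ id u) => //.
  exact: (continuous_subspaceT (fun x : R => @cvg_id _ (nbhs x))).
have Dg i t : (i < r)%N -> t0 < t < te -> is_derive t 1 (g i) (g i.+1 t).
  move=> ir tin; apply: is_derive_along_field.
    have := Cg i (ltnW ir); rewrite -(subnSK ir) => -[dG _]; exact: dG.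
  by rewrite Ff; [exact: Du|case/andP: tin => ? ?; rewrite !ltW].
have [M M0 HM] : exists2 M, 0 <= M & forall t, t0 <= t <= te -> `|g r t| <= M.
  have cn : {within `[t0, te], continuous (fun t => `|g r t|)}.
    exact: (within_comp (@norm_continuous _ _) (cg r (leqnn r))).
  have [c _ Hc] := EVT_max tt cn.
  by exists `|g r c| => // t t_in; apply: Hc; rewrite in_itv.
exists (`|C| * M); first by rewrite mulr_ge0.
move=> a h t0a h0 ahe.
have sub t : a <= t <= a + h -> t0 <= t <= te.
  by move=> /andP[at_ th]; rewrite (le_trans t0a)// (le_trans th).
have g0 t : a <= t <= a + h -> g 0%N t = j t (u t).
  by move=> /sub t_in; rewrite /g /= Gj.
have int_g : \int[lebesgue_measure]_(t in `[a, a + h]) g 0%N t =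
    \int[lebesgue_measure]_(t in `[a, a + h]) j t (u t).
  by apply: eq_Rintegral => t; rewrite inE/= in_itv/=; exact: g0.
have := HC a h g M h0 _ _; rewrite int_g.
under eq_bigr => k _.
  rewrite g0; first over.
  have /andP[g0k g1k] := gam01 k.
  by rewrite lerDl mulr_ge0 ?(ltW h0)//= lerD2l ler_piMl// ltW.
move=> H; apply: (le_trans (H _ _)).
- split=> [i ir|i t ir /andP[at_ th]].
    by apply: within_itvS (cg i ir).
  by apply: Dg => //; rewrite (le_lt_trans t0a)// (lt_le_trans th).
- by move=> t /sub; exact: HM.
have hr : 0 <= h ^+ r.+1 by rewrite exprn_ge0// ltW.
by rewrite mulrAC ler_wpM2r// ler_wpM2r// ler_norm.
Qed.

Lemma integral_over_grid (R : realType) (v : R -> R) (T : nat -> R) (m : nat) :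
  (forall n, (n < m)%N -> T n <= T n.+1) ->
  {within `[T 0%N, T m], continuous v} ->
  \int[lebesgue_measure]_(t in `[T 0%N, T m]) v t =
  \sum_(n < m) \int[lebesgue_measure]_(t in `[T n, T n.+1]) v t.
Proof.
elim: m => [|m IH] Tm cv.
  by rewrite big_ord0 set_itv1 Rintegral_set1.
have T0m : T 0%N <= T m.
  elim: m Tm {IH cv} => [//|m IH] Tm.
  apply: (@le_trans _ _ (T m)); last exact/Tm/ltnW.
  by apply: IH => n nm; apply: Tm; exact: ltnW.
have Tmm : T m <= T m.+1 by exact: Tm.
have iv a b : T 0%N <= a -> b <= T m.+1 ->
    (@lebesgue_measure R).-integrable `[a, b] (EFin \o v).
  move=> Ta bT; apply: continuous_compact_integrable; first exact: segment_compact.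
  exact: within_itvS cv.
rewrite big_ord_recr/= -IH; last 2 first.
- by move=> n nm; apply: Tm; exact: ltnW.
- exact: within_itvS cv.
have := @Rintegral_itvB R v (BLeft (T 0%N)) (BRight (T m.+1)) (T m).
move=> /(_ (iv _ _ (lexx _) (lexx _))); rewrite !bnd_simp => /(_ T0m Tmm).
rewrite Rintegral_itv_obnd_cbnd; last first.
  apply: integrableS (iv _ _ T0m (lexx (T m.+1))) => //.
  by apply: subset_itvr; rewrite bnd_simp.
by move=> <-; rewrite subrKC.
Qed.

(** * The adaptive run *)

(** The deadbeat controller cancels the current step size: only the ratio of the
    tolerance to the constants of the estimate is left. *)
Lemma deadbeat_step_bounds (R : realType) (k : nat) (h tau b M E : R) :
  0 < h -> 0 < tau -> 0 < b -> 0 < M ->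
  b * h ^+ k.+1 <= E <= M * h ^+ k.+1 ->
  (tau / M) `^ (k.+1%:R^-1) <= h * (tau / E) `^ (k.+1%:R^-1)
    <= (tau / b) `^ (k.+1%:R^-1).
Proof.
move=> h0 tau0 b0 M0 /andP[bE EM].
have hk : 0 < h ^+ k.+1 by rewrite exprn_gt0.
have E0 : 0 < E by apply: lt_le_trans bE; rewrite mulr_gt0.
have k0 : 0 <= (k.+1%:R : R)^-1 by rewrite invr_ge0.
have -> : h * (tau / E) `^ k.+1%:R^-1 = (h ^+ k.+1 * (tau / E)) `^ k.+1%:R^-1.
  have tE : 0 <= tau / E by rewrite divr_ge0// ltW.
  rewrite (powRM _ (ltW hk) tE).
  by rewrite -powR_mulrn ?(ltW h0)// -powRrM divff ?powRr1 ?(ltW h0)// pnatr_eq0.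
have pos (x : R) : 0 < x -> 0 <= tau / x.
  by move=> x0; rewrite divr_ge0// ltW.
have hE : 0 <= h ^+ k.+1 * (tau / E) by rewrite mulr_ge0 ?pos// (ltW hk).
have tau_ge0 := ltW tau0.
apply/andP; split; apply: ge0_ler_powR; rewrite ?nnegrE ?pos//.
- by rewrite mulrCA ler_wpM2l// ler_pdivlMr// mulrC ler_pdivrMr// mulrC.
- by rewrite mulrCA ler_wpM2l// ler_pdivrMr// mulrC ler_pdivlMr// mulrC.
Qed.

(** The bound of the discrete Gronwall inequality at time t for one-step errors
    growing by 1 + C h and increased by at most C h e in a step of length h. *)
Definition error_envelope (R : realType) (C e t : R) : R :=
  C * e * t * expR (C * t).

Lemma error_envelope_le (R : realType) (C e s t : R) :
  0 <= C -> 0 <= e -> 0 <= s -> s <= t ->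
  error_envelope C e s <= error_envelope C e t.
Proof.
move=> C0 e0 s0 st; rewrite /error_envelope.
have Ce : 0 <= C * e by exact: mulr_ge0.
apply: ler_pM; rewrite ?expR_ge0 ?mulr_ge0//; first exact: ler_wpM2l.
by rewrite ler_expR ler_wpM2l.
Qed.

(** One step of the discrete Gronwall argument, through 1 + C h <= exp(C h). *)
Lemma error_envelope_step (R : realType) (C e s h k : R) :
  0 <= C -> 0 <= e -> 0 <= s -> 0 <= h -> k <= e ->
  (1 + C * h) * error_envelope C e s + C * (h * k) <=
  error_envelope C e (s + h).
Proof.
move=> C0 e0 s0 h0 ke; rewrite /error_envelope (mulrDr C s h) expRD.
set A := expR (C * s); set X := expR (C * h).
have A1 : 1 <= A by rewrite -expR0 ler_expR mulr_ge0.
have X1 : 1 + C * h <= X := expR_ge1Dx _.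
have X1' : 1 <= X by rewrite (le_trans _ X1)// lerDl mulr_ge0.
have AX : 1 <= A * X by rewrite (le_trans A1)// ler_peMr// (le_trans _ A1).
have P1 : (1 + C * h) * (C * e * s * A) <= X * (C * e * s * A).
  by rewrite ler_wpM2r// !mulr_ge0// (le_trans _ A1).
have P2 : C * (h * k) <= C * (h * e) by rewrite ler_wpM2l// ler_wpM2l.
have P3 : C * (h * e) <= C * (h * e) * (A * X) by rewrite ler_peMr// !mulr_ge0.
lra.
Qed.

(** The invariant of the run.  A positive step is claimed before te only: once te
    is reached, steps are cut off to length zero. *)
Definition on_track (R : realType) (d : nat) (t0 te : R) (u : R -> 'rV[R]_d)
    (C e H : R) (st : state R d) : Prop :=
  [/\ t0 <= time st, time st <= te,
    `|value st - u (time st)| <= error_envelope C e (time st - t0) &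
    time st < te -> [/\ 0 < step st, step st <= H & time st + step st <= te]].

Lemma runS (R : realType) (d : nat) (j : R -> 'rV[R]_d -> R) (t0 te : R)
    (u0 : 'rV[R]_d) (N Nminus : scheme R d) (phat : nat) (tau dt0 : R) n :
  run j t0 te u0 N Nminus phat tau dt0 n.+1 =
  let st := run j t0 te u0 N Nminus phat tau dt0 n in
  State (time st + step st) (N (time st) (step st) (value st))
    (Num.min (step st * (tau / `|estimate j N Nminus (time st) (step st)
        (value st)|) `^ (phat.+1%:R^-1)) (te - (time st + step st))).
Proof. by rewrite /=; case: (run _ _ _ _ _ _ _ _ _ n). Qed.

Section adaptive_run.
Variables (R : realType) (d : nat) (j : R -> 'rV[R]_d -> R) (t0 te : R).
Variables (u : R -> 'rV[R]_d) (N Nminus : scheme R d) (p phat : nat).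
Variables (tau dt0 b M C H h0 e : R).
Hypotheses (t0te : t0 < te) (tau0 : 0 < tau) (b0 : 0 < b) (M0 : 0 < M).
Hypotheses (C0 : 0 <= C) (H0 : 0 < H) (Hh0 : H <= h0) (He : H <= e).
Hypothesis accurate : step_accuracy t0 te u N p C h0.
Hypothesis estimates : forall t h x, t0 <= t -> 0 < h <= e -> t + h <= te ->
  `|x - u t| <= e ->
  b * h ^+ phat.+1 <= `|estimate j N Nminus t h x| <= M * h ^+ phat.+1.
Hypothesis envelope1 : error_envelope C (H ^+ p) (te - t0) <= 1.
Hypothesis envelopee : error_envelope C (H ^+ p) (te - t0) <= e.
Hypotheses (dt00 : 0 < dt0) (dt0H : dt0 <= H).
Hypothesis tau_H : (tau / b) `^ (phat.+1%:R^-1) <= H.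

Let st := run j t0 te (u t0) N Nminus phat tau dt0.
Let track := on_track t0 te u C (H ^+ p) H.
Let hmin := (tau / M) `^ (phat.+1%:R^-1).

Let Hp0 : 0 <= H ^+ p. Proof.
by rewrite exprn_ge0// ltW.
Qed.

Let track0 : track (st 0%N).
Proof.
split=> //=; first exact: ltW.
  by rewrite !subrr normr0 /error_envelope mulr0 mul0r.
move=> _; rewrite lt_min dt00 subr_gt0 t0te ge_min dt0H; split=> //.
by rewrite -lerBrDl ge_min lexx orbT.
Qed.

Let track_err s : track s -> `|value s - u (time s)| <=
  error_envelope C (H ^+ p) (te - t0).
Proof.
case=> ts tse err _; apply: le_trans err _.
by apply: error_envelope_le; rewrite ?subr_ge0// lerB.
Qed.

Let track_step n : track (st n) -> time (st n) < te ->
  track (st n.+1) /\ (time (st n.+1) < te ->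
    time (st n.+1) + step (st n.+1) = te \/ hmin <= step (st n.+1)).
Proof.
move=> tn lt_te; have tnerr := track_err tn.
case: tn => t0t _ err /(_ lt_te)[hp hH the].
have hh0 : 0 < step (st n) <= h0 by rewrite hp (le_trans hH).
have he : 0 < step (st n) <= e by rewrite hp (le_trans hH).
have acc := accurate t0t hh0 the (le_trans tnerr envelope1).
have est := estimates t0t he the (le_trans tnerr envelopee).
have /andP[lo hi] := deadbeat_step_bounds hp tau0 b0 M0 est.
rewrite /st runS -/st /=; split; last first.
  move=> _; rewrite /Num.min; case: ifP => _; first by right.
  by left; rewrite subrKC.
split=> //=; first by rewrite (le_trans t0t)// lerDl ltW.
  apply: (le_trans acc); rewrite addrAC exprS.
  have h0' := ltW hp.
  apply: le_trans (error_envelope_step C0 Hp0 _ h0' _); last first.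
  - by apply: lerXn2r hH; rewrite nnegrE// ltW.
  - by rewrite subr_ge0.
  by rewrite lerD2r ler_wpM2l// addr_ge0// mulr_ge0.
move=> lt'; have hmin0 : 0 < hmin by rewrite powR_gt0// divr_gt0.
rewrite lt_min subr_gt0 lt' (lt_le_trans hmin0 lo); split=> //.
  by rewrite ge_min (le_trans hi tau_H).
by rewrite -lerBrDl ge_min lexx orbT.
Qed.

(** No step but the first and the last one is shorter than hmin, so te is reached
    after finitely many steps. *)
Lemma run_reaches_end : exists m, [/\ is_grid te st m,
  forall n, (n < m)%N -> time (st n) < te &
  forall n, (n <= m)%N -> track (st n)].
Proof.
have [m hm] : exists m, te <= time (st m).
  apply: contrapT => /forallNP no.
  have lt n : time (st n) < te by rewrite ltNge; apply/negP; exact: no.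
  have tr n : track (st n).
    by elim: n => [|n IH]; [exact: track0|have [] := track_step IH (lt n)].
  have time_ge n : t0 + n%:R * hmin <= time (st n.+1).
    elim: n => [|n IH].
      by rewrite mul0r addr0; case: (tr 1%N).
    have [_ /(_ (lt _))[eq_te|hs]] := track_step (tr n) (lt n).
      by have := lt n.+2; rewrite /st runS -/st/= eq_te ltxx.
    rewrite /st runS -/st /= -natr1 mulrDl mul1r addrA.
    exact: lerD.
  have hmin0 : 0 < hmin by rewrite powR_gt0// divr_gt0.
  have := archi_boundP (ltW (divr_gt0 (_ : 0 < te - t0) hmin0)).
  rewrite subr_gt0 => /(_ t0te); set n := Num.bound _.
  rewrite ltr_pdivrMr// ltrBlDl => /lt_trans.
  by move=> /(_ _ (le_lt_trans (time_ge n) (lt _))); rewrite ltxx.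
have ex : exists m, (te <= time (st m)) by exists m.
case: (ex_minnP ex) => {hm}m hm min.
have lt n : (n < m)%N -> time (st n) < te.
  by move=> nm; rewrite ltNge; apply/negP => /min; rewrite leqNgt nm.
have tr n : (n <= m)%N -> track (st n).
  elim: n => [_|n IH nm]; first exact: track0.
  by have [] := track_step (IH (ltnW nm)) (lt n nm).
exists m; split=> //; split.
  move=> n nm; rewrite /st runS -/st /= ltrDl.
  by case: (tr n (ltnW nm)) => _ _ _ /(_ (lt n nm))[].
by apply/eqP; rewrite eq_le hm andbT; case: (tr m (leqnn m)).
Qed.

End adaptive_run.

(** * The error in the quantity of interest *)

(** Order p - 1 suffices for the auxiliary schemes because their local errors,
    of size H^p, do not accumulate: each is added once to the error eps at the
    beginning of the step, which is of that size already. *)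
Lemma node_value_error (R : realType) (d s p : nat) (t0 te : R)
    (u : R -> 'rV[R]_d) (N : scheme R d) (Nk : 'I_s.+1 -> scheme R d)
    (gamma : 'I_s.+1 -> R) (C h0 H eps : R) (st : state R d) k :
  (0 < p)%N -> 0 <= gamma k <= 1 -> 0 <= C -> step_accuracy t0 te u N p C h0 ->
  (0 < gamma k < 1 -> step_accuracy t0 te u (Nk k) p.-1 C h0) ->
  H <= h0 -> H <= 1 -> eps <= 1 -> t0 <= time st -> 0 < step st <= H ->
  time st + step st <= te -> `|value st - u (time st)| <= eps ->
  `|node_value N Nk gamma st k - u (time st + gamma k * step st)|
    <= (1 + C) * eps + C * H ^+ p.
Proof.
case: st => t x h /= p0 /andP[g0 g1] C0 HN HNk Hh0 H1 eps1 t0t /andP[hp hH] the xu.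
have h_ge0 := ltW hp; have H0 : 0 <= H := le_trans h_ge0 hH.
have eps0 : 0 <= eps := le_trans (normr_ge0 _) xu.
have bound (c : R) q : 0 <= c -> c <= H -> (p <= q)%N ->
    (1 + C * c) * `|x - u t| + C * c ^+ q <= (1 + C) * eps + C * H ^+ p.
  move=> c0 cH pq; apply: lerD.
    apply: ler_pM => //; first by rewrite addr_ge0// mulr_ge0.
    by rewrite lerD2l ler_piMr// (le_trans cH).
  rewrite ler_wpM2l// (@le_trans _ _ (H ^+ q))//; first by rewrite lerXn2r ?nnegrE.
  by rewrite ler_wiXn2l.
case: eqVneq => [->|gn0].
  have := bound 0 p (lexx 0) H0 (leqnn p).
  rewrite mul0r addr0 mulr0 addr0 mul1r; apply: le_trans.
  by rewrite lerDl mulr_ge0// exprn_ge0.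
case: eqVneq => [->|gn1].
  rewrite mul1r; apply: (le_trans (HN t h x t0t _ the (le_trans xu eps1))).
    by rewrite hp (le_trans hH).
  exact: bound.
have g01 : 0 < gamma k < 1 by rewrite !lt_neqAle eq_sym gn0 g0 gn1 g1.
have gh : 0 < gamma k * h by rewrite mulr_gt0// lt_neqAle eq_sym gn0.
have ghh : gamma k * h <= h by rewrite ler_piMl.
apply: (le_trans (HNk g01 t (gamma k * h) x t0t _ _ (le_trans xu eps1))).
- by rewrite gh (le_trans ghh)// (le_trans hH).
- by rewrite (le_trans _ the)// lerD2l.
by rewrite prednK//; apply: bound => //; [exact: ltW|exact: le_trans hH].
Qed.

Lemma common_step_accuracy (R : realType) (d s p q : nat) (t0 te : R)
    (f : R -> 'rV[R]_d -> 'rV[R]_d) (u : R -> 'rV[R]_d) (N : scheme R d)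
    (Nk : 'I_s.+1 -> scheme R d) (P : 'I_s.+1 -> bool) : t0 <= te ->
  Ck_slab t0 te 1 f -> solves f t0 te u -> has_order f t0 te N p ->
  (forall k, P k -> has_order f t0 te (Nk k) q) ->
  exists C h0, [/\ 0 <= C, 0 < h0, step_accuracy t0 te u N p C h0 &
    forall k, P k -> step_accuracy t0 te u (Nk k) q C h0].
Proof.
move=> tt fC u_sol HN HNk.
have [C [h [C0 hp HC]]] := order_step_accuracy tt fC u_sol HN.
have /choice[Ck HCk] : forall k, exists z : R * R, [/\ 0 <= z.1, 0 < z.2 &
    P k -> step_accuracy t0 te u (Nk k) q z.1 z.2].
  move=> k; have [Pk|nPk] := boolP (P k); last by exists (0, 1).
  have [C' [h' [C'0 h'p HC']]] := order_step_accuracy tt fC u_sol (HNk k Pk).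
  by exists (C', h').
have [h0 h0p /andP[h0h /allP h0k]] : exists2 h0, 0 < h0 &
    all (fun c => h0 <= c) (h :: [seq (Ck k).2 | k : 'I_s.+1]).
  apply: small_below; rewrite /= hp; apply/allP => _ /mapP[k _ ->].
  by case: (HCk k).
have S0 (Q : pred 'I_s.+1) : 0 <= \sum_(k | Q k) (Ck k).1.
  by apply: sumr_ge0 => k _; case: (HCk k).
exists (C + \sum_k (Ck k).1), h0; split=> //; first exact: addr_ge0.
  by apply: step_accuracy_le HC => //; rewrite lerDl.
move=> k Pk; have [_ _ /(_ Pk)] := HCk k; apply: step_accuracy_le.
  by rewrite (bigD1 k)//= addrCA lerDl addr_ge0.
by apply: h0k; apply/mapP; exists k => //; rewrite mem_enum.
Qed.

(** The error splits into the quadrature error along the exact solution and the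
    perturbation of the integrand at the evaluation points.  Both carry a factor
    h, and the sum of the step lengths over the grid is te - t0. *)
Lemma step_defect (R : realType) (d s r : nat) (t0 te B L Cq D H : R) (p : nat)
    (j : R -> 'rV[R]_d -> R) (u : R -> 'rV[R]_d) (gamma sigma : 'I_s.+1 -> R)
    (w : 'I_s.+1 -> 'rV[R]_d) (t h : R) :
  (forall t x y, t0 <= t <= te -> `|x| <= B + 1 -> `|y| <= B + 1 ->
    `|j t x - j t y| <= L * `|x - y|) -> 0 <= L -> 0 <= Cq ->
  (forall t, t0 <= t <= te -> `|u t| <= B) -> (p <= r)%N ->
  (forall k, 0 <= gamma k <= 1) -> 0 < h <= H -> H <= 1 -> D * H ^+ p <= 1 ->
  t0 <= t -> t + h <= te ->
  `|\int[lebesgue_measure]_(y in `[t, t + h]) j y (u y)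
    - h * \sum_(k < s.+1) sigma k * j (t + gamma k * h) (u (t + gamma k * h))|
    <= Cq * h ^+ r.+1 ->
  (forall k, `|w k - u (t + gamma k * h)| <= D * H ^+ p) ->
  `|\int[lebesgue_measure]_(y in `[t, t + h]) j y (u y)
    - h * \sum_(k < s.+1) sigma k * j (t + gamma k * h) (w k)|
    <= h * ((Cq + (\sum_(k < s.+1) `|sigma k|) * L * D) * H ^+ p).
Proof.
move=> jL L0 Cq0 uB pr g01 /andP[hp hH] H1 DH t0t the quad wu.
have h0 := ltW hp; have H0 := le_trans h0 hH.
set I := \int[_]_(_ in _) _ in quad *.
set Su := \sum_(_ < _) _ in quad; set Sw := \sum_(_ < _) _ * j _ (w _).
have Suw : `|Su - Sw| <= (\sum_(k < s.+1) `|sigma k|) * (L * (D * H ^+ p)).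
  rewrite -sumrB mulr_suml (le_trans (ler_norm_sum _ _ _))// ler_sum// => k _.
  have /andP[g0 g1] := g01 k.
  have gh : gamma k * h <= h by rewrite ler_piMl.
  have tin : t0 <= t + gamma k * h <= te.
    rewrite (le_trans t0t) ?lerDl ?mulr_ge0//=.
    by rewrite (le_trans _ the)// lerD2l.
  rewrite -mulrBr normrM ler_wpM2l// distrC.
  apply: (le_trans (jL _ _ _ tin _ _)).
  - rewrite -(subrK (u (t + gamma k * h)) (w k)) (le_trans (ler_normD _ _))//.
    by rewrite addrC lerD ?uB// (le_trans (wu k)).
  - by rewrite (le_trans (uB _ tin))// lerDl.
  by rewrite ler_wpM2l.
have Q : Cq * h ^+ r.+1 <= h * (Cq * H ^+ p).
  rewrite exprS mulrCA ler_wpM2l// ler_wpM2l//.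
  by rewrite (@le_trans _ _ (H ^+ r))//; [rewrite lerXn2r ?nnegrE|rewrite ler_wiXn2l].
have -> : I - h * Sw = (I - h * Su) + h * (Su - Sw) by ring.
rewrite (le_trans (ler_normD _ _))// (le_trans (lerD (le_trans quad Q) (lexx _)))//.
rewrite normrM (ger0_norm h0) -mulrDr ler_wpM2l// mulrDl lerD2l.
by rewrite (le_trans Suw)// !mulrA.
Qed.

Lemma grid_steps (R : realType) (d : nat) (j : R -> 'rV[R]_d -> R) (t0 te : R)
    u0 (N Nminus : scheme R d) (phat : nat) (tau dt0 : R) m :
  let st := run j t0 te u0 N Nminus phat tau dt0 in
  \sum_(n < m) step (st n) = time (st m) - t0.
Proof.
move=> st; elim: m => [|m IH]; first by rewrite big_ord0 /= subrr.
by rewrite big_ord_recr IH /= /st runS /= addrAC.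
Qed.

Lemma near0_powR (R : realType) (k : nat) (C c : R) : 0 < C -> 0 < c ->
  \forall tau \near (0 : R)^'+, C * tau `^ (k.+1%:R^-1) <= c.
Proof.
move=> C0 c0; have cC : 0 < c / C by rewrite divr_gt0.
near=> tau.
have tau0 : 0 < tau by near: tau; exact: nbhs_right_gt.
have tauc : tau <= (c / C) ^+ k.+1.
  by near: tau; apply: nbhs_right_le; exact: exprn_gt0.
rewrite mulrC -ler_pdivlMr//.
have <- : ((c / C) ^+ k.+1) `^ k.+1%:R^-1 = c / C.
  by rewrite -powR_mulrn ?(ltW cC)// -powRrM divff ?powRr1 ?(ltW cC)// pnatr_eq0.
by apply: ge0_ler_powR; rewrite ?nnegrE ?invr_ge0 ?exprn_ge0 ?(ltW tau0) ?(ltW cC).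
Unshelve. all: by end_near. Qed.

Lemma Ck_slab_le (R : realType) (d : nat) (W : normedModType R) (t0 te : R)
    (k l : nat) (F : R -> 'rV[R]_d -> W) : (l <= k)%N ->
  Ck_slab t0 te k F -> Ck_slab t0 te l F.
Proof. by move=> lk [G [CG GF]]; exists G; split=> //; exact: Ck_le CG. Qed.

Lemma integrand_continuous (R : realType) (d : nat) (t0 te : R)
    (j : R -> 'rV[R]_d -> R) (u : R -> 'rV[R]_d) : Ck_slab t0 te 0 j ->
  {within `[t0, te], continuous u} ->
  {within `[t0, te], continuous (fun t => j t (u t))}.
Proof.
move=> [G [cG Gj]] cu; apply: (within_eq (v := fun t => G (t, u t))).
  by move=> t t_in; exact: Gj.
apply: (@within_comp _ _ _ _ (fun t => (t, u t)) G) => //.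
apply: (@pair_continuous (subspace `[t0, te]) R _ id u) => //.
exact: (continuous_subspaceT (fun x : R => @cvg_id _ (nbhs x))).
Qed.

Theorem theorem5 (R : realType) (d : nat) (t0 te : R) (u0 : 'rV[R]_d)
    (f : R -> 'rV[R]_d -> 'rV[R]_d) (j : R -> 'rV[R]_d -> R)
    (u : R -> 'rV[R]_d)
    (p phat r s : nat)
    (N Nminus : scheme R d) (Nk : 'I_s.+1 -> scheme R d)
    (gamma sigma : 'I_s.+1 -> R)
    (dt0 : R -> R)
    (phi_minus : R -> 'rV[R]_d -> 'rV[R]_d)
    (t0_lt_te : t0 < te)
    (f_smooth : Ck_slab t0 te (maxn p.+1 r) f)
    (j_smooth : Ck_slab t0 te (maxn p.+1 r) j)
    (u_sol : unique_solution f t0 te u0 u)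
    (phat_lt_p : (phat < p)%N)
    (N_order : has_order f t0 te N p)
    (Nminus_order : has_order f t0 te Nminus phat)
    (gamma01 : forall k, 0 <= gamma k <= 1)
    (quad_order : quadrature_order gamma sigma r)
    (p_le_r : (p <= r)%N)
    (Nk_order : forall k, 0 < gamma k < 1 -> has_order f t0 te (Nk k) p.-1)
    (dt0_gt0 : forall tau, 0 < tau -> 0 < dt0 tau)
    (dt0_bigO : exists C : R, \forall tau \near 0^'+,
        dt0 tau <= C * tau `^ (phat.+1%:R^-1))
    (phi_minus_def : principal_error f t0 te Nminus phat phi_minus)
    (controllability : exists2 m : R,
        is_min_on `[t0, te]
          (fun t => `|'d (j t) (u t) (phi_minus t (u t))|) m & 0 < m) :
  exists C : R, \forall tau \near 0^'+,
    let st := run j t0 te u0 N Nminus phat tau (dt0 tau) in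
    exists2 m : nat, is_grid te st m &
      `|QoI j t0 te u - QoI_h j N Nk gamma sigma st m|
        <= C * tau `^ (p%:R / phat.+1%:R).
Proof.
have tt := ltW t0_lt_te; have [sol u_t0 _] := u_sol.
have p0 : (0 < p)%N by case: (p) phat_lt_p.
have le1 : (1 <= maxn p.+1 r)%N by rewrite leq_max.
have f1 := Ck_slab_le le1 f_smooth; have j1 := Ck_slab_le le1 j_smooth.
have fr := Ck_slab_le (leq_maxr p.+1 r) f_smooth.
have jr := Ck_slab_le (leq_maxr p.+1 r) j_smooth.
have [m0 [_ m0_min] m0_gt0] := controllability.
have ctrl t : t0 <= t <= te -> m0 <= `|'d (j t) (u t) (phi_minus t (u t))|.
  by move=> t_in; apply: m0_min; rewrite /= in_itv.
have [M [e [M0 e0 est]]] := estimator_bounds tt phat_lt_p f1 j1 sol N_order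
  Nminus_order phi_minus_def m0_gt0 ctrl.
have [C [h0 [C0 h0_gt0 acc acck]]] := @common_step_accuracy R d s p p.-1 t0 te
  f u N Nk (fun k => 0 < gamma k < 1) tt f1 sol N_order Nk_order.
have [Cq Cq0 quad] := quadrature_error tt fr jr sol gamma01 quad_order.
have [B B0 uB] := solution_bounded tt sol.
have [L L0 jL] : exists2 L, 0 <= L & forall t x y, t0 <= t <= te ->
    `|x| <= B + 1 -> `|y| <= B + 1 -> `|j t x - j t y| <= L * `|x - y|.
  have [G [CG Gj]] := j1; have [L L0 HL] := C1_lipschitz t0 te (B + 1) CG.
  by exists L => // t x y t_in xB yB; rewrite -!Gj//; exact: HL.
have [Cd dt0C] := dt0_bigO.
have b0 : 0 < m0 / 2 by rewrite divr_gt0.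
pose a : R := phat.+1%:R^-1.
(* Cm tau^a bounds the initial step, by the first term, and every step chosen by
   the controller, by the second; the third makes it positive. *)
pose Cm : R := `|Cd| + (m0 / 2)^-1 `^ a + 1.
have Cm0 : 0 < Cm by rewrite /Cm ltr_wpDl// addr_ge0// powR_ge0.
pose K := error_envelope C 1 (te - t0).
have te0 : 0 <= te - t0 by rewrite subr_ge0.
have K0 : 0 <= K by rewrite /K /error_envelope !mulr_ge0// expR_ge0.
have KE x : error_envelope C x (te - t0) = K * x.
  by rewrite /K /error_envelope; ring.
pose D := (1 + C) * K + C.
have D0 : 0 <= D by rewrite /D addr_ge0// mulr_ge0// addr_ge0.
pose S := \sum_(k < s.+1) `|sigma k|.
(* Every upper bound required of H below follows from H <= c; those on H^p do so
   because H^p <= H for H <= 1. *)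
have [c c0 /= /and5P[ch0 ce c1 cK1 /and3P[cKe cD _]]] : exists2 c, 0 < c &
    all (fun z => c <= z) [:: h0; e; 1; (K + 1)^-1; (K + 1)^-1 * e; (D + 1)^-1].
  have iK : 0 < (K + 1)^-1 by rewrite invr_gt0 ltr_wpDl.
  have iD : 0 < (D + 1)^-1 by rewrite invr_gt0 ltr_wpDl.
  by apply: small_below; rewrite /= h0_gt0 e0 ltr01 iK iD mulr_gt0.
exists ((te - t0) * (Cq + S * L * D) * Cm ^+ p); near=> tau.
have tau0 : 0 < tau by near: tau; exact: nbhs_right_gt.
have Hc : Cm * tau `^ a <= c by near: tau; exact: near0_powR.
have dt0tau : dt0 tau <= Cd * tau `^ a by near: tau.
have ta0 : 0 < tau `^ a by exact: powR_gt0.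
pose H := Cm * tau `^ a; rewrite -/H in Hc.
have H0 : 0 < H by rewrite mulr_gt0.
have Hh0 := le_trans Hc ch0; have He := le_trans Hc ce.
have H1 := le_trans Hc c1.
have Hp : H ^+ p <= H by apply: ler_iXnr => //; rewrite ltW.
have small (z b : R) : 0 <= z -> 0 <= b -> c <= (z + 1)^-1 * b -> z * H ^+ p <= b.
  move=> z0 b0' cz; have z1 : 0 < z + 1 by rewrite ltr_wpDl.
  have : H <= (z + 1)^-1 * b := le_trans Hc cz.
  rewrite -ler_pdivrMl ?invr_gt0// invrK; apply: le_trans.
  apply: (le_trans (ler_wpM2l z0 Hp)).
  by rewrite ler_wpM2r ?(ltW H0)// lerDl.
have env1 : error_envelope C (H ^+ p) (te - t0) <= 1.
  by rewrite KE; apply: small => //; rewrite mulr1.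
have enve : error_envelope C (H ^+ p) (te - t0) <= e.
  by rewrite KE; apply: small => //; exact: ltW.
have DH : D * H ^+ p <= 1 by apply: small => //; rewrite mulr1.
have dt0H : dt0 tau <= H.
  apply: (le_trans dt0tau); rewrite ler_wpM2r ?(ltW ta0)// (le_trans (ler_norm _))//.
  by rewrite /Cm -addrA lerDl addr_ge0// powR_ge0.
have tauH : (tau / (m0 / 2)) `^ a <= H.
  rewrite powRM ?(ltW tau0) ?invr_ge0 ?(ltW b0)// mulrC /H ler_wpM2r ?(ltW ta0)//.
  by rewrite /Cm addrAC lerDr addr_ge0.
rewrite -u_t0; set st := run _ _ _ _ _ _ _ _ _.
have [m [grid lt_te trk]] := run_reaches_end t0_lt_te tau0 b0 M0 C0 H0 Hh0 He
  acc est env1 enve (dt0_gt0 _ tau0) dt0H tauH.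
exists m => //; have [incr end_te] := grid.
have st0 : time (st 0%N) = t0 by [].
have stS n : time (st n.+1) = time (st n) + step (st n) by rewrite /st runS.
have cj := integrand_continuous (Ck_slab_le (leq0n _) j1) (proj1 sol).
rewrite /QoI -[X in `[X, _]]st0 -[X in `[_, X]]end_te.
rewrite (@integral_over_grid _ _ (fun n => time (st n))); last 2 first.
- by move=> n nm; exact/ltW/incr.
- by rewrite st0 end_te.
rewrite /QoI_h -sumrB (le_trans (ler_norm_sum _ _ _))//.
have -> : (te - t0) * (Cq + S * L * D) * Cm ^+ p * tau `^ (p%:R / phat.+1%:R) =
    \sum_(n < m) step (st n) * ((Cq + S * L * D) * H ^+ p).
  rewrite -mulr_suml grid_steps -/st end_te /H exprMn -(powR_mulrn _ (ltW ta0)).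
  by rewrite -powRrM (mulrC a) !mulrA.
apply: ler_sum => n _.
have nm := ltn_ord n.
have [t0t _ err /(_ (lt_te _ nm))[hp hH the]] := trk n (ltnW nm).
rewrite stS; apply: (step_defect jL L0 Cq0 uB p_le_r gamma01 _ H1 DH t0t the).
- by rewrite hp.
- exact: quad.
move=> k; have -> : D * H ^+ p = (1 + C) * (K * H ^+ p) + C * H ^+ p.
  by rewrite /D; ring.
apply: (node_value_error p0 (gamma01 k) C0 acc (acck k)) => //.
- by rewrite -KE.
- by rewrite hp.
- rewrite -KE (le_trans err)//; apply: error_envelope_le => //.
  + by rewrite exprn_ge0// ltW.
  + by rewrite subr_ge0.
  + by rewrite lerB// (le_trans _ the)// lerDl ltW.
Unshelve. all: by end_near. Qed.
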